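(* Suppose that $H\in C^4(\mathbb{R}^{2d};\mathbb{R})$ has bounded derivatives of orders $2,3,4$, and that there exists $R>0$ such that the Hessian matrix $\nabla^2H(x)$ is uniformly positive definite for all $x\in\mathbb{R}^{2d}$ with $\|x\|>R$ (i.e. there is $\lambda>0$ with $v^\top\nabla^2H(x)v\ge\lambda\|v\|^2$ for all $v\in\mathbb{R}^{2d}$ and all such $x$). Then there exist constants $C_0,C_1,C_2,C_3$, independent of $\theta$ and $T$, such that for every $\theta\in[0,1]$, every $T>0$ and every $t\in[0,T]$, $$\mathbb{E}\big[\|U_t^\theta\|^2\big]\le e^{C_0t}\Big(C_1(1-2\theta)^2T^4+C_2\big(\theta^2-\theta+\tfrac13\big)T^3+C_3(1-2\theta^2)^2T^2\Big).$$
   Context: Let $d,m\in\mathbb{N}_+$, $T>0$, and let $W,\widetilde W$ be independent $m$-dimensional standard Brownian motions. Let $\sigma\in\mathbb{R}^{2d\times m}$ be a constant matrix with columns $\sigma_{\cdot,1},\dots,\sigma_{\cdot,m}$, and put $b:=J\nabla H$ with $J=\begin{pmatrix}0&I_d\\-I_d&0\end{pmatrix}$. The process $X$ solves $\mathrm{d}X_t=b(X_t)\,\mathrm{d}t+\sigma\,\mathrm{d}W_t$, $t\in[0,T]$, with deterministic initial value $X_0\in\mathbb{R}^{2d}$. $Db(x)$ is the Jacobian matrix and $D^2b(x)(u,v)=\sum_{i,j}\partial_i\partial_jb(x)u_iv_j$. For $\theta\in[0,1]$ the process $U^\theta=\{U^\theta_t\}_{t\in[0,T]}$ (which depends on $T$;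 it is the asymptotic limit of the normalized error of the $\theta$ method on $[0,T]$) is the solution of $$\begin{aligned} U_t^\theta=&\int_{0}^{t}Db(X_s)U_s^\theta\,\mathrm{d}s+\frac{(1-2\theta)T}{2}\int_{0}^{t}Db(X_s)b(X_s)\,\mathrm{d}s+\frac{(1-2\theta)T}{2}\int_{0}^{t}Db(X_s)\sigma\,\mathrm{d}W_s\\ &+\frac{\sqrt 3}{6}T\int_{0}^{t}Db(X_s)\sigma\,\mathrm{d}\widetilde{W}_s+\frac{(1-2\theta^2)T}{4}\sum_{k=1}^{m}\int_{0}^{t}D^2b(X_s)(\sigma_{\cdot,k},\sigma_{\cdot,k})\,\mathrm{d}s . \end{aligned}$$ The constants $C_0,\dots,C_3$ may depend on $H$, $\sigma$, $X_0$, $d$, $m$. *)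

(* Defs.v *)
(* MathComp / MathComp-Analysis *)
From HB Require Import structures.
From mathcomp Require Import all_boot all_order all_algebra.
From mathcomp Require Import all_classical all_reals all_analysis.
Import Order.TTheory GRing.Theory Num.Theory numFieldNormedType.Exports.

Set Implicit Arguments.
Unset Strict Implicit.
Unset Printing Implicit Defensive.

Local Open Scope classical_set_scope.
Local Open Scope ring_scope.

(* The norm that MathComp-Analysis puts on matrices is the sup norm, hence a
   separate Euclidean norm. *)
Definition sqnorm (R : realType) (n : nat) (v : 'cV[R]_n) : R :=
  \sum_(i < n) v i 0 ^+ 2.

Definition enorm (R : realType) (n : nat) (v : 'cV[R]_n) : R :=
  Num.sqrt (sqnorm v).

Definition partial (R : realType) (n : nat) (i : 'I_n) (f : 'cV[R]_n -> R)
    (x : 'cV[R]_n) : R :=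
  'D_(delta_mx i 0) f x.

Definition iter_partial (R : realType) (n : nat) (s : seq 'I_n)
    (f : 'cV[R]_n -> R) : 'cV[R]_n -> R :=
  foldr (@partial R n) f s.

Definition class_C (R : realType) (n k : nat) (f : 'cV[R]_n -> R) : Prop :=
  forall s : seq 'I_n, (size s <= k)%N ->
    continuous (iter_partial s f) /\
    ((size s < k)%N ->
      forall (i : 'I_n) (x : 'cV[R]_n),
        derivable (iter_partial s f) x (delta_mx i 0)).

Definition bounded_derivatives (R : realType) (n k : nat)
    (f : 'cV[R]_n -> R) : Prop :=
  exists M : R, forall (s : seq 'I_n) (x : 'cV[R]_n),
    size s = k -> `|iter_partial s f x| <= M.

Definition gradient (R : realType) (n : nat) (f : 'cV[R]_n -> R)
    (x : 'cV[R]_n) : 'cV[R]_n :=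
  \col_i partial i f x.

Definition hessian (R : realType) (n : nat) (f : 'cV[R]_n -> R)
    (x : 'cV[R]_n) : 'M[R]_n :=
  \matrix_(i, j) partial i (partial j f) x.

(* [derive.jacobian] is for row vectors and is the transpose of this one. *)
Definition Jac (R : realType) (n : nat) (b : 'cV[R]_n -> 'cV[R]_n)
    (x : 'cV[R]_n) : 'M[R]_n :=
  \matrix_(i, j) partial j (fun y => b y i 0) x.

Definition D2 (R : realType) (n : nat) (b : 'cV[R]_n -> 'cV[R]_n)
    (x u v : 'cV[R]_n) : 'cV[R]_n :=
  \col_k \sum_i \sum_j
    partial i (partial j (fun y => b y k 0)) x * u i 0 * v j 0.

Definition symplectic_J (R : realType) (d : nat) : 'M[R]_(d + d) :=
  block_mx 0 1%:M (- 1%:M) 0.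

Definition ham_field (R : realType) (d : nat) (H : 'cV[R]_(d + d) -> R)
    (x : 'cV[R]_(d + d)) : 'cV[R]_(d + d) :=
  symplectic_J R d *m gradient H x.

Definition hessian_posdef_outside_ball (R : realType) (n : nat)
    (H : 'cV[R]_n -> R) (rho : R) : Prop :=
  exists2 lambda : R, 0 < lambda &
    forall x : 'cV[R]_n, rho < enorm x ->
      forall v : 'cV[R]_n,
        lambda * enorm v ^+ 2 <= (v^T *m hessian H x *m v) 0 0.

(* sigma(X_i, i in D) *)
Definition gen_sigma (Omega I : Type) (R : realType) (D : set I)
    (X : I -> Omega -> R) : set (set Omega) :=
  <<s [set E | exists i (A : set R),
         [/\ D i, measurable A & E = X i @^-1` A]] >>.

Definition indep_families (dp : measure_display) (Omega : measurableType dp)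
    (R : realType) (P : probability Omega R) (G1 G2 : set (set Omega)) : Prop :=
  forall A B : set Omega, G1 A -> G2 B -> P (A `&` B) = (P A * P B)%E.

Definition filtration (dp : measure_display) (Omega : measurableType dp)
    (R : realType) (T : R) (F : R -> set (set Omega)) : Prop :=
  (forall t : R, 0 <= t <= T ->
     sigma_algebra setT (F t) /\ F t `<=` measurable) /\
  (forall s t : R, 0 <= s -> s <= t -> t <= T -> F s `<=` F t).

Definition sigma_measurable (Omega : Type) (R : realType)
    (G : set (set Omega)) (f : Omega -> R) : Prop :=
  forall A : set R, measurable A -> G (f @^-1` A).

Definition adapted (Omega : Type) (R : realType) (T : R)
    (F : R -> set (set Omega)) (n : nat) (X : R -> Omega -> 'cV[R]_n) : Prop :=
  forall t : R, 0 <= t <= T ->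
    forall i, sigma_measurable (F t) (fun w => X t w i 0).

Definition as_continuous (dp : measure_display) (Omega : measurableType dp)
    (R : realType) (P : probability Omega R) (T : R)
    (n : nat) (X : R -> Omega -> 'cV[R]_n) : Prop :=
  {ae P, forall w, {within `[0, T], continuous (fun t => X t w)}}.

(* The law N(0, (t - s) I_m) of an increment is expressed on rectangles, which
   determine a probability on R^m; the second parameter of [normal_prob] is the
   standard deviation. *)
Definition brownian_motion (dp : measure_display) (Omega : measurableType dp)
    (R : realType) (P : probability Omega R) (T : R)
    (F : R -> set (set Omega)) (m : nat) (W : R -> Omega -> 'cV[R]_m) : Prop :=
  [/\ adapted T F W,
      as_continuous P T W,
      {ae P, forall w, W 0 w = 0},
      forall s t : R, 0 <= s -> s < t -> t <= T ->
        indep_families P (F s)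
          (gen_sigma [set: 'I_m] (fun j w => W t w j 0 - W s w j 0)) &
      forall s t : R, 0 <= s -> s < t -> t <= T ->
        forall A : 'I_m -> set R, (forall j, measurable (A j)) ->
          P [set w | forall j, A j (W t w j 0 - W s w j 0)] =
          (\prod_(j < m) normal_prob 0 (Num.sqrt (t - s)) (A j))%E].

Definition independent_processes (dp : measure_display)
    (Omega : measurableType dp) (R : realType) (P : probability Omega R) (T : R)
    (m : nat) (W W' : R -> Omega -> 'cV[R]_m) : Prop :=
  let D := [set p : R * 'I_m | 0 <= p.1 <= T] in
  indep_families P (gen_sigma D (fun p w => W p.1 w p.2 0))
                   (gen_sigma D (fun p w => W' p.1 w p.2 0)).

(* Step process: sum over i < sp_size of sp_coef i on ]sp_time i, sp_time i.+1]. *)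
Record step_process (Omega : Type) (R : realType) := StepProcess {
  sp_size : nat;
  sp_time : nat -> R;
  sp_coef : nat -> Omega -> R
}.

Definition simple_process (Omega : Type) (R : realType) (T : R)
    (F : R -> set (set Omega)) (S : step_process Omega R) : Prop :=
  [/\ 0 <= sp_time S 0,
      forall i, (i < sp_size S)%N -> sp_time S i <= sp_time S i.+1,
      sp_time S (sp_size S) <= T &
      forall i, (i < sp_size S)%N ->
        sigma_measurable (F (sp_time S i)) (sp_coef S i) /\
        exists M : R, forall w, `|sp_coef S i w| <= M].

Definition step_value (Omega : Type) (R : realType) (S : step_process Omega R)
    (s : R) (w : Omega) : R :=
  \sum_(i < sp_size S)
    sp_coef S i w * \1_(`]sp_time S i, sp_time S i.+1]%classic) s.

Definition step_integral (Omega : Type) (R : realType)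
    (S : step_process Omega R) (B : R -> Omega -> R) (t : R) (w : Omega) : R :=
  \sum_(i < sp_size S)
    sp_coef S i w *
      (B (Num.min (sp_time S i.+1) t) w - B (Num.min (sp_time S i) t) w).

(* I_t is the L^2(Omega) limit of the integrals of adapted simple processes
   that converge to h in L^2(Omega x [0, T]). *)
Definition ito_integral (dp : measure_display) (Omega : measurableType dp)
    (R : realType) (P : probability Omega R) (T : R)
    (F : R -> set (set Omega)) (h B I : R -> Omega -> R) : Prop :=
  [/\ forall t : R, 0 <= t <= T -> measurable_fun setT (I t),
      {ae P, forall w, {within `[0, T], continuous (fun t => I t w)}} &
      exists S : nat -> step_process Omega R,
        [/\ forall n, simple_process T F (S n),
            (fun n => \int[P]_w \int[lebesgue_measure]_(s in `[0%R, T])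
               ((step_value (S n) s w - h s w) ^+ 2)%:E)%E @ \oo --> 0%E &
            forall t : R, 0 <= t <= T ->
              (fun n => \int[P]_w
                ((step_integral (S n) B t w - I t w) ^+ 2)%:E)%E
                @ \oo --> 0%E]].

Definition ito_integral_vec (dp : measure_display) (Omega : measurableType dp)
    (R : realType) (P : probability Omega R) (T : R)
    (F : R -> set (set Omega)) (n m : nat) (h : R -> Omega -> 'M[R]_(n, m))
    (W : R -> Omega -> 'cV[R]_m) (I : R -> Omega -> 'cV[R]_n) : Prop :=
  exists K : 'I_n -> 'I_m -> R -> Omega -> R,
    (forall i j, ito_integral P T F
       (fun s w => h s w i j) (fun s w => W s w j 0) (K i j)) /\
    (forall (t : R) (w : Omega), I t w = \col_i \sum_j K i j t w).

Definition time_integral (R : realType) (n : nat) (t : R) (f : R -> 'cV[R]_n) :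
    'cV[R]_n :=
  \col_i \int[lebesgue_measure]_(s in `[0, t]) (f s i 0).

(* dX = b(X) dt + sigma dW on [0, T], X_0 = x0. *)
Definition sde_solution (dp : measure_display) (Omega : measurableType dp)
    (R : realType) (P : probability Omega R) (T : R)
    (F : R -> set (set Omega)) (n m : nat) (b : 'cV[R]_n -> 'cV[R]_n)
    (sigma : 'M[R]_(n, m)) (x0 : 'cV[R]_n)
    (W : R -> Omega -> 'cV[R]_m) (X : R -> Omega -> 'cV[R]_n) : Prop :=
  [/\ adapted T F X,
      as_continuous P T X &
      exists2 I : R -> Omega -> 'cV[R]_n,
        ito_integral_vec P T F (fun _ _ => sigma) W I &
        {ae P, forall w, forall t : R, 0 <= t <= T ->
           X t w = x0 + time_integral t (fun s => b (X s w)) + I t w}].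

(* U solves the linear SDE of the limit error of the theta method on [0, T]. *)
Definition limit_error_solution (dp : measure_display)
    (Omega : measurableType dp) (R : realType) (P : probability Omega R) (T : R)
    (F : R -> set (set Omega)) (n m : nat) (b : 'cV[R]_n -> 'cV[R]_n)
    (sigma : 'M[R]_(n, m)) (theta : R) (W W' : R -> Omega -> 'cV[R]_m)
    (X U : R -> Omega -> 'cV[R]_n) : Prop :=
  [/\ adapted T F U,
      as_continuous P T U &
      exists I I' : R -> Omega -> 'cV[R]_n,
        [/\ ito_integral_vec P T F (fun s w => Jac b (X s w) *m sigma) W I,
            ito_integral_vec P T F (fun s w => Jac b (X s w) *m sigma) W' I' &
            {ae P, forall w, forall t : R, 0 <= t <= T ->
               U t w =
                 time_integral t (fun s => Jac b (X s w) *m U s w)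
                 + ((1 - 2 * theta) * T / 2) *:
                     time_integral t (fun s => Jac b (X s w) *m b (X s w))
                 + ((1 - 2 * theta) * T / 2) *: I t w
                 + (Num.sqrt 3 / 6 * T) *: I' t w
                 + ((1 - 2 * theta ^+ 2) * T / 4) *:
                     \sum_(k < m) time_integral t (fun s =>
                       D2 b (X s w) (col k sigma) (col k sigma))}]].

(* Main.v *)
(* Pathwise, two Gronwall estimates bound first the time integral of |X - x0|
   and then |U_t| by a constant times |1 - 2 theta| T t, |1 - 2 theta ^ 2| T t,
   and the Ito integrals at time t together with their time integrals over
   [0, t].  Each Ito integral has second moment O(t), and
   (1 - 2 theta)^2 / 4 + 1 / 12 = theta^2 - theta + 1 / 3; the powers of T come
   from t <= T, and the other powers of t are absorbed by exp (C0 t).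

   Working along paths means that no moment of U has to be finite a priori, and
   the expectation of a squared time integral is bounded by applying Fatou's
   lemma to Riemann sums, which are measurable without any joint measurability
   of the processes. *)
Require Import Defs.
From HB Require Import structures.
From mathcomp Require Import all_boot all_order all_algebra.
From mathcomp Require Import ring lra.
From mathcomp Require Import all_classical all_reals all_analysis.
From mathcomp Require Import measurable_realfun.
Import Order.TTheory GRing.Theory Num.Theory numFieldNormedType.Exports.

Local Open Scope classical_set_scope.
Local Open Scope ring_scope.

Set Implicit Arguments.
Unset Strict Implicit.
Unset Printing Implicit Defensive.

(** Paths are continuous only almost surely, and [ito_integral] records no measurability of its
    integrand: it only says that the integral is an L2 limit of step integrals. Hence the estimates
    are one-sided and rest on monotonicity of integrals. A step integral gets its second moment by
    adding one Gaussian increment at a time, with 8 in place of 1 in front of the variance; only the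
    order in [t] matters, since C1, C2 and C3 are free. The step coefficients approximate a bounded
    integrand but may themselves be large; the excess over the bound is charged to the L2
    approximation error, which vanishes in the limit.

    The forcing [Jac b * b] grows linearly along the path of X, so the noise of X returns in the
    bound for U, multiplied by |1 - 2 theta| T. The square of its time integral has expectation
    O(t^3), which fits the T^4 term once one factor t has gone into the exponential. The pathwise
    bound has seven summands, squared separately at the price of a factor 7. *)

(* The integral of a nonnegative function is a supremum over the simple
   functions below it, hence monotone even without measurability. *)
Lemma le_integral_nonmeas (d : measure_display) (T : measurableType d)
    (R : realType) (mu : {measure set T -> \bar R}) (D : set T)
    (f g : T -> \bar R) :
  (forall x, D x -> 0 <= f x)%E -> (forall x, D x -> f x <= g x)%E ->
  (\int[mu]_(x in D) f x <= \int[mu]_(x in D) g x)%E.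
Proof.
move=> f0 fg.
rewrite !ge0_integralE//; last by move=> x Dx;
  rewrite (le_trans (f0 _ Dx))// fg.
apply: ereal_sup_le => _ [h /= hf <-]; exists h => //= x.
apply: le_trans (hf x) _; rewrite /patch; case: ifPn => // /set_mem; exact: fg.
Qed.

(** The integral of [f] is the difference of those of its positive and negative parts, and each of
    these lies between 0 and the integral of [g]. This is what bounds time integrals of vector
    fields along a path. *)
Lemma le_normr_Rintegral_nonmeas (d : measure_display) (T : measurableType d)
    (R : realType) (mu : {measure set T -> \bar R}) (D : set T)
    (mD : measurable D) (f g : T -> R) :
  mu.-integrable D (EFin \o g) -> (forall x, D x -> `|f x| <= g x) ->
  `|\int[mu]_(x in D) f x| <= \int[mu]_(x in D) g x.
Proof.
move=> ig fg.
have g0 x : D x -> 0 <= g x by move=> Dx; rewrite (le_trans _ (fg _ Dx)).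
have gfin : (\int[mu]_(x in D) (g x)%:E)%E \is a fin_num.
  exact: integrable_fin_num.
have key (h : T -> \bar R) : (forall x, 0 <= h x)%E ->
    (forall x, D x -> h x <= `|f x|%:E)%E ->
    exists2 r : R, (\int[mu]_(x in D) h x = r%:E)%E & 0 <= r <=
      \int[mu]_(x in D) g x.
  move=> h0 hf.
  have hle : (\int[mu]_(x in D) h x <= \int[mu]_(x in D) (g x)%:E)%E.
    apply: le_integral_nonmeas => // x Dx.
    by rewrite (le_trans (hf x Dx))// lee_fin fg.
  have hge : (0 <= \int[mu]_(x in D) h x)%E by exact: integral_ge0.
  have hfin : (\int[mu]_(x in D) h x)%E \is a fin_num.
    by rewrite ge0_fin_numE// (le_lt_trans hle)// ltey_eq gfin.
  exists (fine (\int[mu]_(x in D) h x)%E); first by rewrite fineK.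
  by rewrite fine_ge0//= /Rintegral fine_le.
rewrite {1}/Rintegral integralE.
have [|x _|p -> /andP[p0 pg]] := key (EFin \o f)^\+%E.
- by move=> x; rewrite funepos_ge0.
- by rewrite funeposE ge_max/= !lee_fin normr_ge0 andbT ler_norm.
have [|x _|n -> /andP[n0 ng]] := key (EFin \o f)^\-%E.
- by move=> x; rewrite funeneg_ge0.
- by rewrite funenegE ge_max/= !lee_fin normr_ge0 andbT -normrN ler_norm.
rewrite /= ler_norml; apply/andP; split; lra.
Qed.

(** * Primitives, Gronwall's inequality and Riemann sums on a segment *)

Lemma is_derive_primitive (R : realType) (f : R -> R) (t x : R) :
  {within `[0, t], continuous f} -> 0 < x < t ->
  is_derive x 1 (fun s => \int[lebesgue_measure]_(r in `[0, s]) f r) (f x).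
Proof.
move=> cf /andP[x0 xt].
have t0 : 0 < t by exact: lt_trans xt.
have fi : lebesgue_measure.-integrable `[0, t] (EFin \o f).
  by apply: continuous_compact_integrable => //; exact: segment_compact.
have cx : {for x, continuous f}.
  by apply: (within_continuous_continuous t0 cf); rewrite in_itv/= x0 xt.
have [dF F'] := continuous_FTC1_closed xt fi x0 cx.
by apply: DeriveDef; [exact: dF|rewrite -derive1E; exact: F'].
Qed.

(** [Psi] vanishes at 0 and has derivative a - exp(- L s) (phi - L I phi), which is at least a -
    exp(- L s) a by hypothesis; this is nonnegative because [a] is and the weight is at most 1. So
    Psi t >= 0, which is the claim after multiplication by exp(L t). *)
Lemma le_Rintegral_gronwall (R : realType) (L t : R) (phi a : R -> R) :
  0 <= L -> 0 <= t ->
  {within `[0, t], continuous phi} -> {within `[0, t], continuous a} ->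
  (forall s, 0 <= s <= t -> 0 <= a s) ->
  (forall s, 0 <= s <= t ->
    phi s <= a s + L * \int[lebesgue_measure]_(r in `[0, s]) phi r) ->
  \int[lebesgue_measure]_(r in `[0, t]) phi r <=
  expR (L * t) * \int[lebesgue_measure]_(r in `[0, t]) a r.
Proof.
move=> L0; rewrite le_eqVlt => /predU1P[<- _ _ _ _|t0 cphi ca a0 H].
  by rewrite set_itv1 !Rintegral_set1 mulr0.
have int f : {within `[0, t], continuous f} ->
    lebesgue_measure.-integrable `[0, t] (EFin \o f).
  by move=> cf; apply: continuous_compact_integrable => //;
    exact: segment_compact.
pose I (f : R -> R) s := \int[lebesgue_measure]_(r in `[0, s]) f r.
pose Psi s := I a s - expR (- L * s) * I phi s.
pose dPsi s := a s - expR (- L * s) * (phi s - L * I phi s).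
have dP x : x \in `]0, t[ -> is_derive x 1 Psi (dPsi x).
  rewrite in_itv/= => x0t.
  have da := is_derive_primitive ca x0t;
    have dphi := is_derive_primitive cphi x0t.
  rewrite /Psi /dPsi.
  have dE : is_derive x 1 (fun s => expR (- L * s)) (- L * expR (- L * x)).
    have dl : is_derive x 1 (fun s : R => - L * s) (- L).
      by apply: is_derive_eq; rewrite /GRing.scale/= mulr1.
    by have := is_derive1_comp (is_derive_expR (- L * x)) dl; rewrite mulrC.
  apply: is_derive_eq.
  by rewrite /GRing.scale/=; ring.
have cP : {within `[0, t], continuous Psi}.
  have cI f : {within `[0, t], continuous f} -> {within `[0, t],
    continuous (I f)}.
    by move=> cf; apply: parameterized_integral_continuous;
      [exact: ltW|exact: int].
  move=> x; apply: cvgB; first exact: (cI a ca x).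
  apply: cvgM; last exact: (cI phi cphi x).
  apply: continuous_subspaceT => y.
  by apply: continuous_comp; [exact: mulrl_continuous|exact: continuous_expR].
have [c] := MVT t0 dP cP.
rewrite in_itv/= => /andP[c0 ct] E.
have : 0 <= Psi t - Psi 0.
  rewrite E subr0 mulr_ge0 ?(ltW t0)// /dPsi.
  have ac : 0 <= a c by rewrite a0// !ltW.
  have Hc : phi c <= a c + L * I phi c by apply: H; rewrite !ltW.
  have e1 : expR (- L * c) <= 1 by rewrite -expR0 ler_expR mulNr oppr_le0
    mulr_ge0// ltW.
  have e0 : 0 <= expR (- L * c) by exact: expR_ge0.
  have : expR (- L * c) * (phi c - L * I phi c) <= 1 * a c.
    apply: (@le_trans _ _ (expR (- L * c) * a c)); last by rewrite ler_wpM2r.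
    by rewrite ler_wpM2l// lerBlDr.
  by rewrite mul1r subr_ge0.
rewrite /Psi /I set_itv1 !Rintegral_set1 mulr0 !subr0 subr_ge0 => le.
have -> : \int[lebesgue_measure]_(r in `[0,
  t]) phi r = expR (L * t) * (expR (- L * t) * \int[lebesgue_measure]_(r in
  `[0, t]) phi r).
  by rewrite mulrA -expRD mulNr subrr expR0 mul1r.
by rewrite ler_wpM2l ?expR_ge0.
Qed.

(** Heine-Cantor through the near-covering form of compactness: [P del x] holds for all points near
    a given one and all small [del], and compactness of the segment makes one [del] serve every
    point. *)
Lemma segment_unif_continuous (R : realType) (a b : R) (g : R -> R) :
  {within `[a, b], continuous g} -> forall e, 0 < e ->
  exists2 del, 0 < del & forall x y, a <= x <= b -> a <= y <= b ->
    `|x - y| < del -> `|g x - g y| < e.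
Proof.
move=> cg e e0.
pose P (del x : R) := a <= x <= b ->
  forall y, a <= y <= b -> `|x - y| < del -> `|g x - g y| < e.
have local (x : R) : `[a, b]%classic x -> \forall x' \near x & i \near
  (0:R)^'+, P i x'.
  move=> xab.
  have : \forall y \near within `[a, b] (nbhs x), `|g x - g y| < e / 2.
    apply: cvgr_dist_lt; last by rewrite divr_gt0.
    have := cg x; rewrite /prop_for /continuous_at.
    by move=> /(cvg_trans _); apply; rewrite nbhs_subspace_in.
  rewrite near_withinE => /nbhs_ballP[del/= del0 Hdel].
  exists (ball x (del / 2), [set i | i < del / 2]) => /=.
    by split; [apply: nbhsx_ballx; rewrite divr_gt0|apply: nbhs_right_lt;
      rewrite divr_gt0].
  move=> [x' i]/= [xx' idel] x'ab y yab x'y.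
  rewrite -ball_normE /= in xx' Hdel.
  have h1 : `|g x - g x'| < e / 2.
    by apply: Hdel; rewrite /= ?in_itv//= (lt_trans xx')// ltr_pdivrMr//
      ltr_pMr// ltr1n.
  have h2 : `|g x - g y| < e / 2.
    apply: Hdel; rewrite /= ?in_itv//=.
    rewrite (splitr del) (le_lt_trans (ler_distD x' _ _))// ltrD//.
    exact: lt_trans idel.
  by rewrite (splitr e) (le_lt_trans (ler_distD (g x) _ _))// ltrD// distrC.
have : \forall del \near (0:R)^'+, `[a, b] `<=` P del.
  by move/compact_near_coveringP : (@segment_compact R a b); exact.
move=> near_del; near (0:R)^'+ => del.
exists del => // x y xab; have : `[a, b] `<=` P del by near: del.
by move=> /(_ x); apply; rewrite /= ?in_itv.
Unshelve. all: by end_near. Qed.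

Definition riemann_sum (R : realType) (g : R -> R) (t : R) (n : nat) : R :=
  t / n.+1%:R * \sum_(i < n.+1) g (t * (i%:R / n.+1%:R)).

(** On each cell the mean value theorem writes the increment of the primitive as the step length
    times a value of [g] inside the cell, which uniform continuity compares with the value at the
    left endpoint; the increments telescope to the integral. *)
Lemma riemann_sum_cvg (R : realType) (g : R -> R) (t : R) :
  0 <= t -> {within `[0, t], continuous g} ->
  riemann_sum g t n @[n --> \oo] --> \int[lebesgue_measure]_(s in `[0, t]) g s.
Proof.
rewrite le_eqVlt => /predU1P[<- _|t0 cg].
  rewrite set_itv1 Rintegral_set1 (_ : riemann_sum g 0 = cst 0);
    first exact: cvg_cst.
  by apply/funext => n; rewrite /riemann_sum !mul0r.
pose F s := \int[lebesgue_measure]_(r in `[0, s]) g r.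
have cF : {within `[0, t], continuous F}.
  apply: parameterized_integral_continuous; first exact: ltW.
  by apply: continuous_compact_integrable => //; exact: segment_compact.
have F0 : F 0 = 0 by rewrite /F set_itv1 Rintegral_set1.
apply/cvgrPdist_le => e e0.
(* The tolerance e / t makes the n.+1 cell errors, each at most t / n.+1 * (e / t), add up to
   [e]. *)
have [del del0 Hdel] := segment_unif_continuous cg (divr_gt0 e0 t0).
have : \forall n \near \oo, n.+1%:R^-1 < del / t.
  exact: (near_infty_natSinv_lt (PosNum (divr_gt0 del0 t0))).
apply: filterS => n nlt.
pose x (i : nat) : R := t * (i%:R / n.+1%:R).
have n0 : 0 < n.+1%:R :> R by rewrite ltr0n.
have xS i : x i.+1 - x i = t / n.+1%:R.
  by rewrite /x -mulrBr -mulrBl -natrB// subSnn mul1r.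
have h0 : 0 < t / n.+1%:R by rewrite divr_gt0.
have hdel : t / n.+1%:R < del by rewrite -ltr_pdivlMl// mulrC.
have x_ge0 i : 0 <= x i by rewrite mulr_ge0 ?divr_ge0 // ltW.
have x_le i : (i <= n.+1)%N -> x i <= t.
  by move=> ni; rewrite ger_pMr// ler_pdivrMr// mul1r ler_nat.
have xlt i : x i < x i.+1 by rewrite -subr_gt0 xS.
have step (i : nat) : (i < n.+1)%N ->
    `|F (x i.+1) - F (x i) - t / n.+1%:R * g (x i)| <= t / n.+1%:R * (e / t).
  move=> ni.
  have [||c] := @MVT R F g (x i) (x i.+1) (xlt i).
  - move=> y; rewrite in_itv/= => /andP[y1 y2]; apply: (is_derive_primitive cg).
    by rewrite (le_lt_trans _ y1)//= (lt_le_trans y2)// x_le.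
  - apply: continuous_subspaceW cF; apply: subset_itv; rewrite bnd_simp//.
    exact: x_le.
  rewrite in_itv/= => /andP[c1 c2] ->;
    rewrite xS mulrC -mulrBr normrM gtr0_norm// ler_wpM2l// ?ltW//.
  apply: Hdel.
  - by rewrite (le_trans (x_ge0 i) (ltW c1)) (le_trans (ltW c2))// x_le.
  - by rewrite x_ge0 x_le// ltnW.
  - by rewrite gtr0_norm ?subr_gt0// (lt_trans _ hdel)// -(xS i) ltrD2r.
rewrite -[X in `|X - _|]/(F t).
have -> : F t = \sum_(i < n.+1) (F (x i.+1) - F (x i)).
  rewrite -(big_mkord xpredT (fun i => F (x i.+1) - F (x i))).
  rewrite (telescope_sumr (fun i => F (x i)))//.
  by rewrite /x mul0r mulr0 F0 subr0 divff ?mulr1// gt_eqF.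
rewrite /riemann_sum mulr_sumr -sumrB (le_trans (ler_norm_sum _ _ _))//.
apply: (@le_trans _ _ (\sum_(i < n.+1) t / n.+1%:R * (e / t))).
  by apply: ler_sum => i _; exact: step.
rewrite sumr_const card_ord -mulr_natl.
rewrite le_eqVlt; apply/orP; left; apply/eqP; field.
by rewrite ?gt_eqF.
Qed.

(** * Bounds on expectations of functions that may fail to be measurable *)

Lemma sqr_sum_le (R : realFieldType) (n : nat) (a : 'I_n -> R) :
  (\sum_i a i) ^+ 2 <= n%:R * \sum_i a i ^+ 2.
Proof.
elim: n a => [|n IH] a; first by rewrite !big_ord0 mulr0 expr0n.
rewrite !big_ord_recr/=.
set S := \sum_(i < n) _; set Q := \sum_(i < n) _; set x := a ord_max.
have {}IH : S ^+ 2 <= n%:R * Q by exact: IH.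
(* The cross term of (S + x)^2, bounded termwise by 2 a_i x <= a_i^2 + x^2. *)
have H : 2 * S * x <= Q + n%:R * x ^+ 2.
  have -> : n%:R * x ^+ 2 = \sum_(i < n) x ^+ 2.
    by rewrite sumr_const card_ord mulr_natl.
  rewrite -big_split/= mulr_sumr mulr_suml.
  by apply: ler_sum => i _; have := sqr_ge0 (a (widen_ord (leqnSn n) i) - x);
    rewrite sqrrB; lra.
rewrite -natr1 sqrrD; lra.
Qed.

(* [f] need not be measurable: it will involve time integrals of paths that are
   only almost surely continuous. *)
Definition expectation_below (dp : measure_display) (Omega : measurableType dp)
    (R : realType) (P : probability Omega R) (f : Omega -> R) (K : R) : Prop :=
  exists g : Omega -> \bar R,
    [/\ measurable_fun setT g, forall w, (0 <= g w)%E,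
        {ae P, forall w, ((f w)%:E <= g w)%E} & (\int[P]_w g w <= K%:E)%E].

Section ExpectationBelow.
Context (dp : measure_display) (Omega : measurableType dp) (R : realType).
Context (P : probability Omega R).
Implicit Types (f g : Omega -> R) (K c : R).

Lemma expectation_below_le f g K : {ae P, forall w, f w <= g w} ->
  expectation_below P g K -> expectation_below P f K.
Proof.
move=> fg [h [mh h0 gh hK]]; exists h; split => //.
by apply: filterS2 fg gh => w fgw; apply: le_trans; rewrite lee_fin.
Qed.

Lemma expectation_below_leK f K K' : K <= K' ->
  expectation_below P f K -> expectation_below P f K'.
Proof.
move=> KK' [h [mh h0 gh hK]]; exists h; split => //.
by apply: le_trans hK _; rewrite lee_fin.
Qed.

Lemma expectation_belowD f g K K' : expectation_below P f K ->
  expectation_below P g K' -> expectation_below P (fun w => f w + g w) (K + K').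
Proof.
move=> [h [mh h0 gh hK]] [h' [mh' h0' gh' hK']].
exists (fun w => h w + h' w)%E; split => //.
- exact: emeasurable_funD.
- by move=> w; rewrite adde_ge0.
- by apply: filterS2 gh gh' => w; rewrite EFinD; exact: leeD.
- by rewrite ge0_integralD// EFinD leeD.
Qed.

Lemma expectation_belowZ f K c : 0 <= c -> expectation_below P f K ->
  expectation_below P (fun w => c * f w) (c * K).
Proof.
move=> c0 [h [mh h0 gh hK]]; exists (fun w => c%:E * h w)%E; split => //.
- exact: measurable_funeM.
- by move=> w; rewrite mule_ge0.
- by apply: filterS gh => w; rewrite EFinM; exact: lee_wpmul2l.
- by rewrite ge0_integralZl// EFinM lee_wpmul2l.
Qed.

Lemma expectation_below_cst c : 0 <= c -> expectation_below P (fun=> c) c.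
Proof.
move=> c0; exists (cst c%:E); split => //; first exact: aeW.
by rewrite integral_cst// -[leLHS]/(c%:E * P setT)%E probability_setT mule1.
Qed.

Lemma expectation_below_sum (n : nat) (f : 'I_n -> Omega -> R) (K : 'I_n -> R) :
  (forall i, expectation_below P (f i) (K i)) ->
  expectation_below P (fun w => \sum_i f i w) (\sum_i K i).
Proof.
elim: n f K => [|n IH] f K fK.
  rewrite big_ord0 (_ : (fun _ => _) = cst 0);
    first exact: expectation_below_cst.
  by apply/funext => w; rewrite big_ord0.
rewrite big_ord_recr/= (_ : (fun _ => _) =
  fun w => \sum_(i < n) f (widen_ord (leqnSn n) i) w + f ord_max w); last first.
  by apply/funext => w; rewrite big_ord_recr.
by apply: expectation_belowD => //;
  exact: (IH (fun i => f (widen_ord (leqnSn n) i))).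
Qed.

Lemma expectation_below_integral f K : measurable_fun setT f ->
  (forall w, 0 <= f w) ->
  (\int[P]_w (f w)%:E <= K%:E)%E -> expectation_below P f K.
Proof.
move=> mf f0 fK; exists (EFin \o f); split => //; last exact: aeW.
exact/measurable_EFinP.
Qed.

Lemma integral_expectation_below f K : measurable_fun setT f ->
  (forall w, 0 <= f w) ->
  expectation_below P f K -> (\int[P]_w (f w)%:E <= K%:E)%E.
Proof.
move=> mf f0 [h [mh h0 gh]]; apply: le_trans.
apply: ae_ge0_le_integral => //; first by move=> w _; rewrite lee_fin.
  exact/measurable_EFinP.
by apply: filterS gh => w.
Qed.

(** The majorant is the lower limit of the squared Riemann sums: it is measurable on all of [Omega]
    and equals the squared integral wherever the path is continuous. By Cauchy-Schwarz each squared
    sum has expectation at most (t / (n + 1))^2 (n + 1) (n + 1) K = t^2 K. *)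
Lemma expectation_below_sqr_Rintegral (g : R -> Omega -> R) (t K : R) :
  0 <= t ->
  (forall s, 0 <= s <= t -> measurable_fun setT (g s)) ->
  {ae P, forall w, {within `[0, t], continuous (fun s => g s w)}} ->
  (forall s, 0 <= s <= t -> (\int[P]_w (g s w ^+ 2)%:E <= K%:E)%E) ->
  expectation_below P
    (fun w => (\int[lebesgue_measure]_(s in `[0, t]) g s w) ^+ 2) (t ^+ 2 * K).
Proof.
move=> t0 mg cg gK.
have node (n : nat) (i : 'I_n.+1) : 0 <= t * (i%:R / n.+1%:R) <= t.
  rewrite mulr_ge0 ?divr_ge0//= ler_piMr// ler_pdivrMr ?ltr0n// mul1r ler_nat.
  exact/ltnW.
pose G n w : \bar R := ((riemann_sum (fun s => g s w) t n) ^+ 2)%:E.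
have mG n : measurable_fun setT (G n).
  apply/measurable_EFinP/measurable_funX/measurable_funM => //.
  by apply: measurable_sum => i; exact: mg.
have GK n : (\int[P]_w G n w <= (t ^+ 2 * K)%:E)%E.
  have : expectation_below P
      (fun w => (t / n.+1%:R) ^+ 2 * (n.+1%:R *
        \sum_(i < n.+1) g (t * (i%:R / n.+1%:R)) w ^+ 2))
      ((t / n.+1%:R) ^+ 2 * (n.+1%:R * \sum_(i < n.+1) K)).
    apply: expectation_belowZ; first exact: sqr_ge0.
    apply: expectation_belowZ => //; apply: expectation_below_sum => i.
    apply: expectation_below_integral => [|w|]; last exact: gK.
      by apply: measurable_funX; exact: mg.
    exact: sqr_ge0.
  move=> H; apply: integral_expectation_below => [|w|]; last 1 first.
  - apply: (expectation_below_le (aeW P _)); last first.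
      apply: expectation_below_leK H; rewrite sumr_const card_ord -mulr_natl.
      rewrite le_eqVlt; apply/orP; left; apply/eqP; field.
      by rewrite nat1r pnatr_eq0.
    move=> w; rewrite /riemann_sum exprMn ler_wpM2l ?sqr_ge0//.
    exact: (sqr_sum_le (fun i : 'I_n.+1 => g (t * (i%:R / n.+1%:R)) w)).
  - exact/measurable_EFinP/mG.
  - exact: sqr_ge0.
exists (fun w => limn_einf (G ^~ w)); split.
- apply: measurableT_comp => //; apply: measurable_fun_limn_esup => n.
  exact: measurableT_comp.
- move=> w; rewrite limn_einf_lim; apply: lime_ge; first exact: is_cvg_einfs.
  apply: nearW => n; apply: le_ereal_inf_tmp => _ [m _ <-].
  by rewrite lee_fin sqr_ge0.
- apply: filterS cg => w cg.
  have : G n w @[n --> \oo] -->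
      ((\int[lebesgue_measure]_(s in `[0, t]) g s w) ^+ 2)%:E.
    apply: cvg_EFin; first exact: nearW.
    by apply: cvgM; exact: riemann_sum_cvg.
  by move=> /cvg_limn_einf_sup[-> _].
- apply: le_trans (fatou _ _ _ _) _ => //.
    by move=> n w _; rewrite lee_fin sqr_ge0.
  rewrite limn_einf_lim; apply: lime_le; first exact: is_cvg_einfs.
  apply: nearW => n; apply: le_trans (GK n).
  by apply: ereal_inf_lbound; exists n => /=.
Qed.

End ExpectationBelow.

(** * Second moments of normal laws *)

Lemma ge0_integral_normal_prob (R : realType) (m s : R) (f : R -> \bar R) :
  measurable_fun setT f -> (forall x, 0 <= f x)%E ->
  (\int[normal_prob m s]_x f x =
   \int[lebesgue_measure]_x (f x * (normal_pdf m s x)%:E))%E.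
Proof.
move=> mf f0.
have dom := normal_prob_dominates m s.
rewrite -(Radon_Nikodym_SigmaFinite.change_of_variables dom)//.
have iRN := Radon_Nikodym_SigmaFinite.f_integrable dom.
apply: ae_eq_integral => //.
- by apply: emeasurable_funM => //; exact: measurable_int iRN.
- apply: emeasurable_funM => //; apply/measurable_EFinP.
  exact: measurable_normal_pdf.
(* The Radon-Nikodym derivative agrees almost everywhere with the Gaussian density, since both
   integrate to [normal_prob] over every measurable set. *)
- apply: ae_eqe_mul2l => /=; apply: integral_ae_eq => //.
    by apply/measurable_EFinP; exact: measurable_normal_pdf.
  by move=> E _ mE; rewrite -Radon_Nikodym_SigmaFinite.f_integral.
Qed.

Lemma ge0_integral_comp_oppr (R : realType) (f : R -> R) :
  (forall x, 0 <= f x) -> continuous f ->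
  (\int[lebesgue_measure]_x (f (- x))%:E = \int[lebesgue_measure]_x (f x)%:E)%E.
Proof.
(* The negative half-line is folded onto the positive one, so that reflecting [g] merely exchanges
   the two summands. *)
have half (g : R -> R) : (forall x, 0 <= g x) -> continuous g ->
    (\int[lebesgue_measure]_x (g x)%:E =
     \int[lebesgue_measure]_(x in `[0%R, +oo[) (g x)%:E +
     \int[lebesgue_measure]_(x in `[0%R, +oo[) (g (- x))%:E)%E.
  move=> g0 cg.
  have mg : measurable_fun setT g by exact: continuous_measurable_fun.
  rewrite -(setUv `[0%R, +oo[%classic) ge0_integral_setU//=; last 4 first.
  - exact: measurableC.
  - by apply/measurable_EFinP; rewrite setUv.
  - by move=> x _; rewrite lee_fin.
  - exact/disj_setPCl.
  congr (_ + _)%E.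
  rewrite setCitvr integral_itv_bndo_bndc;
    last exact/measurable_EFinP/measurable_funTS.
  by rewrite -{1}oppr0 ge0_integration_by_substitutionNy//;
    exact: continuous_subspaceT.
move=> f0 cf; rewrite (half f)// (half (fun x => f (- x)))//; last first.
  by move=> x; apply: continuous_comp; [exact: opp_continuous|exact: cf].
by rewrite addeC; under eq_integral do rewrite opprK.
Qed.

(* [x ^ 2 <= 4 s ^ 2 exp (x ^ 2 / (4 s ^ 2))] turns the density of standard
   deviation [s] into that of standard deviation [sqrt 2 * s]. *)
Lemma normal_sqr_le (R : realType) (s : R) : s != 0 ->
  (\int[normal_prob 0 s]_x (x ^+ 2)%:E <= (8 * s ^+ 2)%:E)%E.
Proof.
move=> s0; rewrite ge0_integral_normal_prob; last 2 first.
- by apply/measurable_EFinP; exact: measurable_funX.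
- by move=> x; rewrite lee_fin sqr_ge0.
have s20 : 0 < s ^+ 2 by rewrite exprn_even_gt0.
pose r := Num.sqrt 2 * s.
have r2 : r ^+ 2 = 2 * s ^+ 2 by rewrite exprMn sqr_sqrtr.
have r0 : r != 0 by rewrite mulf_neq0// gt_eqF// sqrtr_gt0.
have pk : normal_peak s = Num.sqrt 2 * normal_peak r.
  rewrite /normal_peak r2.
  have -> : Num.sqrt (2 * s ^+ 2 * pi *+ 2) =
    Num.sqrt 2 * Num.sqrt (s ^+ 2 * pi *+ 2).
    by rewrite -sqrtrM//; congr Num.sqrt; ring.
  by rewrite invfM mulrA divff ?mul1r.
(* The ratio sqrt 2 of the two peaks is rounded up to 2; with the 4 from x^2 = 4 s^2 u this gives
   the constant 8. *)
have sqrt2 : Num.sqrt 2 <= 2 :> R.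
  have : Num.sqrt 2 ^+ 2 = 2 :> R by rewrite sqr_sqrtr.
  have := sqrtr_ge0 (2 : R); nra.
apply: (@le_trans _ _ (\int[lebesgue_measure]_x
    ((8 * s ^+ 2)%:E * (normal_pdf 0 r x)%:E))%E); last first.
  rewrite ge0_integralZl//=; last 3 first.
  - by apply/measurable_EFinP; exact: measurable_normal_pdf.
  - by move=> x _; rewrite lee_fin normal_pdf_ge0.
  - by rewrite lee_fin mulr_ge0// ltW.
  by rewrite integral_normal_pdf mule1.
apply: le_integral_nonmeas => x _.
  by rewrite lee_fin mulr_ge0 ?sqr_ge0// normal_pdf_ge0.
rewrite -!EFinM lee_fin !normal_pdfE// pk /normal_fun subr0 r2.
(* In this variable the exponents for the deviations [s] and [r] are - 2 u and - u. One factor exp(-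
   u) is spent on u exp(- u) <= 1, the other stays in the new density. *)
set u := x ^+ 2 / (4 * s ^+ 2).
have u0 : 0 <= u by rewrite divr_ge0 ?sqr_ge0// mulr_ge0// ltW.
have -> : - x ^+ 2 / (s ^+ 2 *+ 2) = - u - u.
  by rewrite /u -mulr_natr; field.
have -> : - x ^+ 2 / ((2 * s ^+ 2) *+ 2) = - u.
  by rewrite /u -mulr_natr; field.
have -> : x ^+ 2 = 4 * s ^+ 2 * u by rewrite /u; field.
rewrite expRD.
have e1 : u * expR (- u) <= 1.
  rewrite -[leRHS](expRxMexpNx_1 u) ler_wpM2r ?expR_ge0//.
  by apply: le_trans (expR_ge1Dx u); rewrite lerDr.
have p0 : 0 <= normal_peak r := normal_peak_ge0 r.
have e0 : 0 <= expR (- u) := expR_ge0 _.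
set p := normal_peak r in p0 *; set e := expR (- u) in e0 e1 *.
have -> : 4 * s ^+ 2 * u * (Num.sqrt 2 * p * (e * e)) =
  4 * s ^+ 2 * (p * e) * (Num.sqrt 2 * (u * e)) by ring.
have -> : 8 * s ^+ 2 * (p * e) = 4 * s ^+ 2 * (p * e) * (2 * 1) by ring.
apply: ler_wpM2l.
  by rewrite mulr_ge0// mulr_ge0// ltW.
by apply: ler_pM => //; rewrite mulr_ge0.
Qed.

(** The centered law is symmetric, so (m + c x)^2 and (m - c x)^2 have the same integral. Their sum
    is 2 m^2 + 2 c^2 x^2, in which the cross term has cancelled before any integration. *)
Lemma normal_sqr_affine_le (R : realType) (s m c : R) : s != 0 ->
  (\int[normal_prob 0 s]_x ((m + c * x) ^+ 2)%:E <=
   (m ^+ 2 + 8 * s ^+ 2 * c ^+ 2)%:E)%E.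
Proof.
move=> s0.
pose f x : R := (m + c * x) ^+ 2 * normal_pdf 0 s x.
have mq (k : R) : measurable_fun setT (fun x : R => ((m + k * x) ^+ 2)%:E).
  apply/measurable_EFinP/measurable_funX/measurable_funD => //.
have -> : (\int[normal_prob 0 s]_x ((m + c * x) ^+ 2)%:E =
    \int[lebesgue_measure]_x (f x)%:E)%E.
  by rewrite ge0_integral_normal_prob// => x; rewrite lee_fin sqr_ge0.
have fN : (\int[lebesgue_measure]_x (f x)%:E =
    \int[normal_prob 0 s]_x ((m + - c * x) ^+ 2)%:E)%E.
  rewrite -ge0_integral_comp_oppr.
  - rewrite ge0_integral_normal_prob; [|exact: mq|by move=> x;
      rewrite lee_fin sqr_ge0].
    apply: eq_integral => x _; rewrite /f EFinM mulrN mulNr.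
    by rewrite !normal_pdfE// /normal_fun !subr0 sqrrN.
  - by move=> x; rewrite /f mulr_ge0 ?sqr_ge0 ?normal_pdf_ge0.
  - have cq : continuous (fun x : R => m + c * x).
      by move=> x; apply: cvgD; [exact: cvg_cst|exact: mulrl_continuous].
    move=> x; apply: cvgM; last exact: continuous_normal_pdf.
    exact: (cvgM (cq x) (cq x)).
have : (\int[lebesgue_measure]_x (f x)%:E + \int[lebesgue_measure]_x (f x)%:E <=
    (2 * (m ^+ 2 + 8 * s ^+ 2 * c ^+ 2))%:E)%E.
  rewrite {2}fN.
  have {1}-> : (\int[lebesgue_measure]_x (f x)%:E =
      \int[normal_prob 0 s]_x ((m + c * x) ^+ 2)%:E)%E.
    by rewrite ge0_integral_normal_prob// => x; rewrite lee_fin sqr_ge0.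
  rewrite -ge0_integralD//; last 4 first.
  - by move=> x _; rewrite lee_fin sqr_ge0.
  - exact: mq.
  - by move=> x _; rewrite lee_fin sqr_ge0.
  - exact: mq.
  have parallelogram (x : R) : (((m + c * x) ^+ 2)%:E + ((m +
    - c * x) ^+ 2)%:E =
      (2 * m ^+ 2)%:E + (2 * c ^+ 2)%:E * (x ^+ 2)%:E)%E.
    by rewrite -EFinM -!EFinD; congr EFin; ring.
  under eq_integral do rewrite parallelogram.
  rewrite ge0_integralD//=; last 3 first.
  - by move=> x _; rewrite lee_fin mulr_ge0// sqr_ge0.
  - by move=> x _; rewrite -EFinM lee_fin mulr_ge0 ?sqr_ge0// mulr_ge0//
      sqr_ge0.
  - by apply/measurable_EFinP/measurable_funM => //; exact: measurable_funX.
  rewrite ge0_integralZl//=; last 3 first.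
  - by apply/measurable_EFinP; exact: measurable_funX.
  - by move=> x _; rewrite lee_fin sqr_ge0.
  - by rewrite lee_fin mulr_ge0// sqr_ge0.
  rewrite integral_cst//= (_ : normal_prob 0 s setT = 1%E);
    last exact: probability_setT.
  rewrite mule1 mulrDr EFinD leeD2l//.
  apply: (@le_trans _ _ ((2 * c ^+ 2)%:E * (8 * s ^+ 2)%:E)%E).
    by rewrite lee_wpmul2l ?normal_sqr_le// lee_fin mulr_ge0// sqr_ge0.
  by rewrite -EFinM lee_fin le_eqVlt; apply/orP; left; apply/eqP; ring.
(* Halving an inequality between extended reals: the doubled one excludes the value +oo. *)
case: (\int[lebesgue_measure]_x (f x)%:E)%E => [r| |]//=.
  by rewrite -EFinD !lee_fin => h; lra.
by move=> _; rewrite leNye.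
Qed.

(* The Gaussian increment [D] is integrated out first: given [(M, c)] it is
   centered, so that no cross term and no integrability of [M * D] appear. *)
Lemma indep_normal_sqr_le (dp : measure_display) (Omega : measurableType dp)
    (R : realType) (P : probability Omega R) (M c D : Omega -> R) (s : R) :
  s != 0 -> measurable_fun setT M -> measurable_fun setT c ->
  measurable_fun setT D ->
  (forall (A : set (R * R)) (B : set R), measurable A -> measurable B ->
    P ((fun w => (M w, c w)) @^-1` A `&` D @^-1` B) =
    (P ((fun w => (M w, c w)) @^-1` A) * normal_prob 0 s B)%E) ->
  (\int[P]_w ((M w + c w * D w) ^+ 2)%:E <=
   \int[P]_w (M w ^+ 2 + 8 * s ^+ 2 * c w ^+ 2)%:E)%E.
Proof.
move=> s0 mM mc mD ind.
have mX : measurable_fun setT (fun w =>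
  (M w, c w)) by exact: measurable_fun_pair.
have mZ : measurable_fun setT
    (fun w => ((M w, c w), (D w : measurableTypeR R))).
  by apply: measurable_fun_pair => //; exact: mD.
pose X : {RV P >-> (R * R)%type} := mfun_Sub (mem_set mX).
pose Z : {RV P >-> (R * R * measurableTypeR R)%type} := mfun_Sub (mem_set mZ).
pose N : probability (measurableTypeR R) R := normal_prob 0 s.
pose h (z : R * R * measurableTypeR R) : \bar R := ((z.1.1 +
  z.1.2 * z.2) ^+ 2)%:E.
pose k (x : R * R) : \bar R := (x.1 ^+ 2 + 8 * s ^+ 2 * x.2 ^+ 2)%:E.
have mh : measurable_fun setT h.
  apply/measurable_EFinP/measurable_funX/measurable_funD.
    by apply: measurableT_comp => //.
  apply: measurable_funM => //.
  by apply: measurableT_comp => //.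
have mk : measurable_fun setT k.
  apply/measurable_EFinP/measurable_funD; first exact: measurable_funX.
  by apply: measurable_funM => //; exact: measurable_funX.
have h0 z : (0 <= h z)%E by rewrite lee_fin sqr_ge0.
have k0 z : (0 <= k z)%E.
  by rewrite lee_fin addr_ge0 ?sqr_ge0// mulr_ge0 ?sqr_ge0// mulr_ge0 ?sqr_ge0.
have -> : (\int[P]_w ((M w +
  c w * D w) ^+ 2)%:E = \int[distribution P Z]_z h z)%E.
  by rewrite (ge0_integral_distribution Z).
have -> : (\int[P]_w (M w ^+ 2 + 8 * s ^+ 2 * c w ^+ 2)%:E =
    \int[distribution P X]_x k x)%E.
  by rewrite (ge0_integral_distribution X).
(* The hypothesis on rectangles identifies the joint law of ((M, c), D) with the product of the law
   of (M, c) and the normal law. *)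
have -> : (\int[distribution P Z]_z h z =
    \int[distribution P X \x N]_z h z)%E.
  apply: eq_measure_integral => A mA _; apply/esym.
  apply: (product_measure_unique (m' := distribution P Z)) => //.
rewrite fubini_tonelli1//.
apply: le_integral_nonmeas => [x _|x _]; first exact: integral_ge0.
exact: normal_sqr_affine_le.
Qed.

(** * Measurability and Gaussian increments relative to a filtration *)

Lemma sigma_measurable_funP (dp : measure_display) (Omega : measurableType dp)
    (d' : measure_display) (T : measurableType d')
    (G : set (set Omega)) (f : Omega -> T) : sigma_algebra setT G ->
  (forall A, measurable A -> G (f @^-1` A)) <->
  measurable_fun setT (f : g_sigma_algebraType G -> T).
Proof.
move=> sG; split => [Gf _ A mA|mf A mA].
  by rewrite setTI; apply: sub_sigma_algebra; exact: Gf.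
have := mf measurableT A mA; rewrite setTI.
(* Being a sigma-algebra, [G] coincides with the one it generates. Closure of [sigma_measurable G]
   under arithmetic can thus be read off [g_sigma_algebraType G]. *)
by rewrite /measurable/= (sigma_algebra_id sG).
Qed.

Section SubSigmaAlgebra.
Context (dp : measure_display) (Omega : measurableType dp) (R : realType).
Context (G : set (set Omega)) (sG : sigma_algebra setT G).
Implicit Types f g : Omega -> R.

Lemma sigma_measurableD f g : sigma_measurable G f -> sigma_measurable G g ->
  sigma_measurable G (fun w => f w + g w).
Proof.
move=> /(sigma_measurable_funP _ sG) mf /(sigma_measurable_funP _ sG) mg.
by apply/(sigma_measurable_funP _ sG); exact: measurable_funD.
Qed.

Lemma sigma_measurableB f g : sigma_measurable G f -> sigma_measurable G g ->
  sigma_measurable G (fun w => f w - g w).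
Proof.
move=> /(sigma_measurable_funP _ sG) mf /(sigma_measurable_funP _ sG) mg.
by apply/(sigma_measurable_funP _ sG); exact: measurable_funB.
Qed.

Lemma sigma_measurableM f g : sigma_measurable G f -> sigma_measurable G g ->
  sigma_measurable G (fun w => f w * g w).
Proof.
move=> /(sigma_measurable_funP _ sG) mf /(sigma_measurable_funP _ sG) mg.
by apply/(sigma_measurable_funP _ sG); exact: measurable_funM.
Qed.

Lemma sigma_measurable_cst (c : R) : sigma_measurable G (fun=> c).
Proof. by apply/(sigma_measurable_funP _ sG); exact: measurable_cst. Qed.

Lemma sigma_measurable_pair f g (A : set (R * R)) :
  sigma_measurable G f -> sigma_measurable G g -> measurable A ->
  G ((fun w => (f w, g w)) @^-1` A).
Proof.
move=> /(sigma_measurable_funP _ sG) mf /(sigma_measurable_funP _ sG) mg mA.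
by apply: (sigma_measurable_funP _ sG).2 => //; exact: measurable_fun_pair.
Qed.

End SubSigmaAlgebra.

Lemma sigma_measurable_sub (Omega : Type) (R : realType)
    (G G' : set (set Omega)) (f : Omega -> R) : G `<=` G' ->
  sigma_measurable G f -> sigma_measurable G' f.
Proof. by move=> GG' Gf A mA; exact/GG'/Gf. Qed.

Lemma sigma_measurable_measurable (dp : measure_display)
    (Omega : measurableType dp) (R : realType)
    (G : set (set Omega)) (f : Omega -> R) : G `<=` measurable ->
  sigma_measurable G f -> measurable_fun setT f.
Proof. by move=> Gm Gf _ A mA; rewrite setTI; exact/Gm/Gf. Qed.

(** The one product formula encodes both that the increment is independent of [F s] and that it is
    normal with variance t - s. *)
Definition gaussian_increments (dp : measure_display)
    (Omega : measurableType dp) (R : realType) (P : probability Omega R) (T : R)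
    (F : R -> set (set Omega)) (B : R -> Omega -> R) : Prop :=
  (forall t, 0 <= t <= T -> sigma_measurable (F t) (B t)) /\
  (forall s t, 0 <= s -> s < t -> t <= T ->
    forall (A : set Omega) (C : set R), F s A -> measurable C ->
    P (A `&` (fun w => B t w - B s w) @^-1` C) =
    (P A * normal_prob 0 (Num.sqrt (t - s)) C)%E).

Lemma brownian_gaussian_increments (dp : measure_display)
    (Omega : measurableType dp) (R : realType) (P : probability Omega R) (T : R)
    (F : R -> set (set Omega)) (m : nat) (W : R -> Omega -> 'cV[R]_m)
    (j : 'I_m) :
  brownian_motion P T F W -> gaussian_increments P T F (fun s w => W s w j 0).
Proof.
move=> [adW _ _ indW lawW]; split => [t t0T|s t s0 st tT A C FA mC].
  exact: adW.
rewrite (indW s t)//; last first.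
  by apply: sub_sigma_algebra; exists j, C.
congr (_ * _)%E.
(* The law of one coordinate, as the rectangle whose other sides are the whole line. *)
pose C' (i : 'I_m) : set R := if i == j then C else setT.
have mC' i : measurable (C' i) by rewrite /C'; case: ifP.
rewrite (_ : _ @^-1` _ = [set w | forall i, C' i (W t w i 0 - W s w i 0)]).
  rewrite lawW// (bigD1 j)//= big1 ?mule1; first by rewrite /C' eqxx.
  by move=> i /negbTE ij; rewrite /C' ij; exact: probability_setT.
rewrite eqEsubset; split => w /= Cw.
  by move=> i; rewrite /C'; case: eqVneq => // ->.
by have := Cw j; rewrite /C' eqxx.
Qed.

(** * Second moment of a step integral *)

Section StepIntegral.
Context (dp : measure_display) (Omega : measurableType dp) (R : realType).
Context (P : probability Omega R) (T : R) (F : R -> set (set Omega)).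
Context (hF : filtration T F) (B : R -> Omega -> R).
Context (hB : gaussian_increments P T F B).
Context (S : step_process Omega R) (hS : simple_process T F S).

Lemma sp_time_le i j : (i <= j <= sp_size S)%N -> sp_time S i <= sp_time S j.
Proof.
case: hS => _ inc _ _ /andP[ij jS].
elim: j ij jS => [|j IH]; first by rewrite leqn0 => /eqP->.
rewrite leq_eqVlt => /predU1P[->//|ij] jS.
by apply: le_trans (inc _ jS); apply: IH => //; exact: ltnW.
Qed.

Lemma sp_time_itv i : (i <= sp_size S)%N -> 0 <= sp_time S i <= T.
Proof.
move=> iS; case: hS => t0 _ tT _; apply/andP; split.
  by apply: le_trans t0 _; apply: sp_time_le.
by apply: le_trans tT; apply: sp_time_le; rewrite iS leqnn.
Qed.

Lemma sp_coef_measurable i : (i < sp_size S)%N ->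
  measurable_fun setT (sp_coef S i).
Proof.
move=> iS; case: hS => _ _ _ /(_ i iS)[Fi _].
apply: sigma_measurable_measurable Fi.
by case: hF => /(_ (sp_time S i)) []//; exact: sp_time_itv (ltnW iS).
Qed.

(** The variance of the i-th increment in [step_integral], whose cells are cut at [t]. *)
Definition sp_length (t : R) (i : nat) : R :=
  Num.min (sp_time S i.+1) t - Num.min (sp_time S i) t.

Lemma sp_length_ge0 t i : (i < sp_size S)%N -> 0 <= sp_length t i.
Proof.
move=> iS; rewrite subr_ge0 le_min ge_min ge_min lexx !orbT andbT.
by rewrite sp_time_le// leqnSn.
Qed.

(** One direction of the Ito isometry, up to the factor 8. Each induction step adds one increment by
    [indep_normal_sqr_le], for which the partial sum and the next coefficient must be known when the
    increment starts; so measurability of the partial sum at [tau k] is carried along. *)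
Lemma step_integral_sqr_le t : 0 <= t <= T ->
  measurable_fun setT (step_integral S B t) /\
  (\int[P]_w (step_integral S B t w ^+ 2)%:E <=
   \int[P]_w (\sum_(i < sp_size S) 8 * sp_length t i * sp_coef S i w ^+
     2)%:E)%E.
Proof.
move=> /andP[t0 tT].
pose M k w := \sum_(i < k) sp_coef S i w *
  (B (Num.min (sp_time S i.+1) t) w - B (Num.min (sp_time S i) t) w).
pose Q k w := \sum_(i < k) 8 * sp_length t i * sp_coef S i w ^+ 2.
pose tau k := Num.min (sp_time S k) t.
have tau_itv k : (k <= sp_size S)%N -> 0 <= tau k <= T.
  move=> kS; have /andP[h1 h2] := sp_time_itv kS.
  by rewrite le_min h1 t0/= ge_min h2.
have Fsub s : 0 <= s <= T -> F s `<=` measurable.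
  by move=> sT; have [+ _] := hF => /(_ s sT)[].
have Fsig s : 0 <= s <= T -> sigma_algebra setT (F s).
  by move=> sT; have [+ _] := hF => /(_ s sT)[].
suff H k : (k <= sp_size S)%N -> sigma_measurable (F (tau k)) (M k) /\
    (\int[P]_w (M k w ^+ 2)%:E <= \int[P]_w (Q k w)%:E)%E.
  have [H1 H2] := H _ (leqnn _); split => //.
  by apply: sigma_measurable_measurable H1; apply: Fsub; exact: tau_itv.
elim: k => [_|k IH kS].
  split.
    rewrite (_ : M 0 = cst 0); last by apply/funext => w; rewrite /M big_ord0.
    by apply: sigma_measurable_cst; apply: Fsig; exact: tau_itv.
  apply: le_integral_nonmeas => w _; first by rewrite lee_fin sqr_ge0.
  by rewrite /M /Q !big_ord0 expr0n.
have [mM IHM] := IH (ltnW kS).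
have tau0 := tau_itv k (ltnW kS); have tau1 := tau_itv k.+1 kS.
have /andP[tau0_ge0 tau0T] := tau0; have /andP[tau1_ge0 tau1T] := tau1.
have tauS : tau k <= tau k.+1 by rewrite -subr_ge0 sp_length_ge0.
have FS : F (tau k) `<=` F (tau k.+1) by case: hF => _; exact.
pose D w := B (tau k.+1) w - B (tau k) w.
have ME : M k.+1 = fun w => M k w + sp_coef S k w * D w.
  by apply/funext => w; rewrite /M big_ord_recr.
have QE : Q k.+1 = fun w => Q k w + 8 * (tau k.+1 - tau k) * sp_coef S k w ^+ 2.
  by apply/funext => w; rewrite /Q big_ord_recr.
have mMk : measurable_fun setT (M k).
  by apply: sigma_measurable_measurable mM; exact: Fsub.
have mck := sp_coef_measurable kS.
have mQ : measurable_fun setT (Q k).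
  apply: measurable_sum => i; apply: measurable_funM => //.
  by apply: measurable_funX; apply: sp_coef_measurable; exact: ltn_trans kS.
have Q0 w : 0 <= Q k w.
  apply: sumr_ge0 => i _; rewrite mulr_ge0 ?sqr_ge0// mulr_ge0//
    sp_length_ge0//.
  exact: ltn_trans kS.
(* A cell that becomes empty when cut at [t] contributes nothing. It is split off because the normal
   law of an increment is available for positive variance only. *)
move: tauS; rewrite le_eqVlt => /predU1P[tauE|taulE].
  have D0 w : D w = 0 by rewrite /D tauE subrr.
  have -> : M k.+1 = M k by rewrite ME; apply/funext => w;
    rewrite D0 mulr0 addr0.
  have -> : Q k.+1 = Q k.
    by rewrite QE; apply/funext => w; rewrite tauE subrr mulr0 mul0r addr0.
  by split => //; exact: sigma_measurable_sub mM.
(* A cell that stays nonempty starts before [t], so [tau k] is the original node, and the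
   coefficient is measurable at [tau k]. *)
have tkt : sp_time S k < t.
  rewrite ltNge; apply/negP => ttk; move: taulE; rewrite ltNge => /negP; apply.
  by rewrite /tau (min_idPr ttk) ge_min lexx orbT.
have tauk : tau k = sp_time S k by rewrite /tau (min_idPl (ltW tkt)).
have Fck : sigma_measurable (F (tau k)) (sp_coef S k).
  by rewrite tauk; case: hS => _ _ _ /(_ k kS)[].
have [mB lawB] := hB.
have FD : sigma_measurable (F (tau k.+1)) D.
  apply: sigma_measurableB; [exact: Fsig|exact: mB|].
  by apply: sigma_measurable_sub FS _; exact: mB.
split.
  rewrite ME; apply: sigma_measurableD;
    [exact: Fsig|exact: sigma_measurable_sub mM|].
  apply: sigma_measurableM => //; first exact: Fsig.
  exact: sigma_measurable_sub Fck.
have s20 : 0 < tau k.+1 - tau k by rewrite subr_gt0.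
have mD : measurable_fun setT D.
  by apply: sigma_measurable_measurable FD; exact: Fsub.
have sqrt0 : Num.sqrt (tau k.+1 - tau k) != 0 by rewrite gt_eqF// sqrtr_gt0.
have step := @indep_normal_sqr_le _ _ _ P (M k) (sp_coef S k) D _ sqrt0 mMk mck
  mD.
rewrite ME; apply: le_trans (step _) _ => [A C mA mC|].
  by apply: lawB => //; apply: sigma_measurable_pair => //; exact: Fsig.
rewrite (sqr_sqrtr (ltW s20)) QE.
under eq_integral do rewrite EFinD.
under [X in (_ <= X)%E]eq_integral do rewrite EFinD.
have mc2 : measurable_fun setT
    (fun w => (8 * (tau k.+1 - tau k) * sp_coef S k w ^+ 2)%:E).
  by apply/measurable_EFinP/measurable_funM => //; exact: measurable_funX.
have c20 w : (0 <= (8 * (tau k.+1 - tau k) * sp_coef S k w ^+ 2)%:E)%E.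
  by rewrite lee_fin mulr_ge0 ?sqr_ge0// mulr_ge0// ltW.
rewrite ge0_integralD//; last 2 first.
- by move=> w _; rewrite lee_fin sqr_ge0.
- by apply/measurable_EFinP; exact: measurable_funX.
rewrite ge0_integralD//; last 2 first.
- by move=> w _; rewrite lee_fin.
- exact/measurable_EFinP.
by rewrite leeD2r.
Qed.

End StepIntegral.

(** * Passage from step integrals to Ito integrals *)

Section ItoBound.
Context (dp : measure_display) (Omega : measurableType dp) (R : realType).
Context (P : probability Omega R) (T : R) (F : R -> set (set Omega)).
Context (hF : filtration T F) (B : R -> Omega -> R).
Context (hB : gaussian_increments P T F B).

(* [x ^ 2 <= 2 M ^ 2 + 2 sqr_excess x], and [sqr_excess x <= (x - h) ^ 2] as soon
   as [|h| <= M]: comparing with [sqr_excess] makes the measurability of [h]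
   irrelevant. *)
Definition sqr_excess (M x : R) : R := Num.max 0 (x ^+ 2 / 2 - M ^+ 2).

Lemma sqr_excess_ge0 M x : 0 <= sqr_excess M x.
Proof. by rewrite /sqr_excess le_max lexx. Qed.

Lemma sqr_excess_le M x h : `|h| <= M -> sqr_excess M x <= (x - h) ^+ 2.
Proof.
move=> hM; rewrite ge_max sqr_ge0/=.
have : h ^+ 2 <= M ^+ 2 by rewrite -(real_normK (num_real h)) lerXn2r//
  nnegrE (le_trans _ hM).
(* (x - h)^2 - (x^2 / 2 - h^2) = 2 (x / 2 - h)^2. *)
have := sqr_ge0 (x / 2 - h); nra.
Qed.

Lemma sqr_le_sqr_excess M x : x ^+ 2 <= 2 * M ^+ 2 + 2 * sqr_excess M x.
Proof.
have : x ^+ 2 / 2 - M ^+ 2 <=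
  sqr_excess M x by rewrite /sqr_excess le_max lexx orbT.
lra.
Qed.

Lemma measurable_sqr_excess M (c : Omega -> R) : measurable_fun setT c ->
  measurable_fun setT (fun w => sqr_excess M (c w)).
Proof.
move=> mc; apply: measurable_maxr => //; apply: measurable_funB => //.
by apply: measurable_funM => //; exact: measurable_funX.
Qed.

Lemma step_value_in (S : step_process Omega R) i s w : simple_process T F S ->
  (i < sp_size S)%N -> sp_time S i < s <= sp_time S i.+1 ->
  step_value S s w = sp_coef S i w.
Proof.
move=> hS iS /andP[is1 is2]; rewrite /step_value (bigD1 (Ordinal iS))//=.
rewrite indicE mem_set ?mulr1 /= ?in_itv/= ?is1//.
rewrite big1 ?addr0// => j ji; rewrite indicE memNset ?mulr0//= in_itv/=.
apply/negP; rewrite negb_and -leNgt -ltNge.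
have := ji; rewrite -val_eqE /= neq_ltn => /orP[jlt|ilt].
  rewrite [X in _ || X](le_lt_trans _ is1) ?orbT//.
  by apply: (sp_time_le hS); rewrite jlt ltnW.
rewrite (le_trans is2)//; apply: (sp_time_le hS).
by rewrite ilt ltnW.
Qed.

(** The sum is the integral of a step function that lies below the integrand on the right: by
    [sqr_excess_le] inside a cell, and because it vanishes outside all cells. *)
Lemma sum_excess_le (S : step_process Omega R) (h : R -> R) (M : R) w :
  simple_process T F S -> (forall s, `|h s| <= M) ->
  ((\sum_(i < sp_size S) sqr_excess M (sp_coef S i w) *
      (sp_time S i.+1 - sp_time S i))%:E <=
   \int[lebesgue_measure]_(s in `[0%R,
     T]) ((step_value S s w - h s) ^+ 2)%:E)%E.
Proof.
move=> hS hM.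
pose I (i : nat) : set R := `]sp_time S i, sp_time S i.+1]%classic.
have -> : ((\sum_(i < sp_size S) sqr_excess M (sp_coef S i w) *
      (sp_time S i.+1 - sp_time S i))%:E =
    \int[lebesgue_measure]_(s in `[0%R, T])
      (\sum_(i < sp_size S) (sqr_excess M (sp_coef S i w))%:E * (\1_(I i)
        s)%:E))%E.
  rewrite ge0_integral_sum//=; last 2 first.
  - move=> i; apply/measurable_EFinP; apply: measurable_funM => //.
    exact: (measurable_indic (measurable_itv `]sp_time S i, sp_time S i.+1])).
  - by move=> j s _; rewrite -EFinM lee_fin mulr_ge0 ?sqr_excess_ge0.
  rewrite -sumEFin; apply: eq_bigr => i _.
  rewrite ge0_integralZl_EFin ?sqr_excess_ge0//=; last first.
    apply/measurable_EFinP.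
    exact: (measurable_indic (measurable_itv `]sp_time S i, sp_time S i.+1])).
  rewrite integral_indic//=; last exact: measurable_itv.
  rewrite (_ : I i `&` `[0, T] = I i); last first.
    apply/setIidPl => s; rewrite /I /= !in_itv/= => /andP[s1 s2].
    have /andP[a0 _] := sp_time_itv hS (ltnW (ltn_ord i)).
    have /andP[_ bT] := sp_time_itv hS (ltn_ord i).
    by rewrite (le_trans a0 (ltW s1)) (le_trans s2 bT).
  rewrite /I lebesgue_measure_itv/= lte_fin.
  have : sp_time S i <= sp_time S i.+1 by apply: (sp_time_le hS);
    rewrite leqnSn ltn_ord.
  rewrite le_eqVlt => /predU1P[->|lt]; first by rewrite ltxx subrr mulr0 mule0.
  by rewrite lt -EFinD.
apply: le_integral_nonmeas => s _.
  by apply: sume_ge0 => i _; rewrite -EFinM lee_fin mulr_ge0 ?sqr_excess_ge0.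
under eq_bigr do rewrite -EFinM.
rewrite sumEFin lee_fin.
have [[i sI]|noI] := pselect (exists i : 'I_(sp_size S), I i s).
  rewrite (bigD1 i)//= indicE mem_set// mulr1 big1 ?addr0.
    move: (sI); rewrite /I /= in_itv/= => /(step_value_in w hS (ltn_ord i)) ->.
    exact: sqr_excess_le.
  move=> j ji; rewrite indicE memNset ?mulr0// => sJ.
  move: sI sJ; rewrite /I /= !in_itv/= => /andP[i1 i2] /andP[j1 j2].
  move: ji; rewrite -val_eqE /= neq_ltn => /orP[lt|lt].
    have : sp_time S j.+1 <= sp_time S i by apply: (sp_time_le hS);
      rewrite lt ltnW.
    by move=> /(le_trans j2); rewrite leNgt i1.
  have : sp_time S i.+1 <= sp_time S j by apply: (sp_time_le hS);
    rewrite lt ltnW.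
  by move=> /(le_trans i2); rewrite leNgt j1.
rewrite big1 ?sqr_ge0// => i _; rewrite indicE memNset ?mulr0// => sI.
by apply: noI; exists i.
Qed.

(** In c^2 <= 2 M^2 + 2 [sqr_excess], the part with M^2 is summed over the cells cut at [t], whose
    lengths telescope to at most [t]; the excess is kept over the full cells, to match
    [sum_excess_le]. Both constants are 16 = 8 * 2. *)
Lemma sum_sqr_coef_le (S : step_process Omega R) (M t : R) w :
  simple_process T F S -> 0 <= t <= T ->
  \sum_(i < sp_size S) 8 * sp_length S t i * sp_coef S i w ^+ 2 <=
  16 * M ^+ 2 * t + 16 * \sum_(i < sp_size S) sqr_excess M (sp_coef S i w) *
      (sp_time S i.+1 - sp_time S i).
Proof.
move=> hS /andP[t0 tT].
have len i : (i < sp_size S)%N -> sp_length S t i <=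
  sp_time S i.+1 - sp_time S i.
  move=> iS; have := sp_time_le hS (i := i) (j := i.+1) _;
    rewrite leqnSn iS => /(_ isT).
  by rewrite /sp_length => ?; case: (leP (sp_time S i.+1) t) => ?;
    case: (leP (sp_time S i) t) => ?; lra.
have lent : \sum_(i < sp_size S) sp_length S t i <= t.
  rewrite -(big_mkord xpredT (sp_length S t)) /sp_length.
  rewrite (telescope_sumr (fun i => Num.min (sp_time S i) t))//.
  have : Num.min (sp_time S (sp_size S)) t <= t by rewrite ge_min lexx orbT.
  have : 0 <= Num.min (sp_time S 0) t.
    by rewrite le_min t0 andbT; have /andP[] := sp_time_itv hS (leq0n _).
  by lra.
apply: (@le_trans _ _ (16 * M ^+ 2 * (\sum_(i < sp_size S) sp_length S t i) +
    16 * \sum_(i < sp_size S) sqr_excess M (sp_coef S i w) *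
      (sp_time S i.+1 - sp_time S i))); last first.
  by rewrite lerD2r ler_wpM2l// mulr_ge0// sqr_ge0.
rewrite !mulr_sumr -big_split/=; apply: ler_sum => i _.
have := len i (ltn_ord i); have := sp_length_ge0 hS t (ltn_ord i).
have := sqr_excess_ge0 M (sp_coef S i w);
  have := sqr_le_sqr_excess M (sp_coef S i w).
set e := sqr_excess _ _; set l := sp_length _ _ _; set d := _ - sp_time S i.
set x := sp_coef S i w ^+ 2 => h1 h2 h3 h4.
have : l * x <= l * (2 * M ^+ 2 + 2 * e) by rewrite ler_wpM2l.
have : e * l <= e * d by rewrite ler_wpM2l.
lra.
Qed.

(** With J the n-th step integral, I^2 <= 2 J^2 + 2 (J - I)^2, and J^2 has expectation at most 16
    M^2 t + 16 [eps n]. Both errors tend to 0, which leaves 32 = 2 * 16. *)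
Lemma ito_integral_sqr_le (h I : R -> Omega -> R) (M t : R) :
  ito_integral P T F h B I -> (forall s w, `|h s w| <= M) -> 0 <= t <= T ->
  (\int[P]_w (I t w ^+ 2)%:E <= (32 * M ^+ 2 * t)%:E)%E.
Proof.
move=> [mI _ [S [hS cvgS cvgI]]] hM t0T; have /andP[t0 tT] := t0T.
pose eps n := (\int[P]_w \int[lebesgue_measure]_(s in `[0%R, T])
   ((step_value (S n) s w - h s w) ^+ 2)%:E)%E.
pose del n := (\int[P]_w ((step_integral (S n) B t w - I t w) ^+ 2)%:E)%E.
have M0 : 0 <= M by rewrite (le_trans _ (hM 0 point)).
have bound n : (\int[P]_w (I t w ^+ 2)%:E <=
    (32 * M ^+ 2 * t)%:E + 32%:E * eps n + 2%:E * del n)%E.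
  have [mJ leJ] := step_integral_sqr_le hF hB (hS n) t0T.
  pose E w := \sum_(i < sp_size (S n)) sqr_excess M (sp_coef (S n) i w) *
    (sp_time (S n) i.+1 - sp_time (S n) i).
  have E0 w : 0 <= E w.
    apply: sumr_ge0 => i _; rewrite mulr_ge0 ?sqr_excess_ge0// subr_ge0.
    by apply: (sp_time_le (hS n)); rewrite leqnSn ltn_ord.
  have mE : measurable_fun setT E.
    apply: measurable_sum => i; apply: measurable_funM => //.
    by apply: measurable_sqr_excess; exact: (sp_coef_measurable hF (hS n)).
  have leE : (\int[P]_w (E w)%:E <= eps n)%E.
    by apply: le_integral_nonmeas => w _;
      [rewrite lee_fin|exact: sum_excess_le].
  have leJ' : (\int[P]_w (step_integral (S n) B t w ^+ 2)%:E <=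
      (16 * M ^+ 2 * t)%:E + 16%:E * eps n)%E.
    apply: (le_trans leJ).
    apply: (@le_trans _ _ (\int[P]_w ((16 * M ^+ 2 * t)%:E +
      16%:E * (E w)%:E))%E).
      apply: le_integral_nonmeas => w _.
        rewrite lee_fin; apply: sumr_ge0 => i _;
          rewrite mulr_ge0 ?sqr_ge0// mulr_ge0//.
        exact: (sp_length_ge0 (hS n)).
      by rewrite -EFinM -EFinD lee_fin; exact: (sum_sqr_coef_le _ _ (hS n)).
    rewrite ge0_integralD//=; last 3 first.
    - by move=> w _; rewrite lee_fin mulr_ge0// mulr_ge0// sqr_ge0.
    - by move=> w _; rewrite -EFinM lee_fin mulr_ge0.
    - by apply/measurable_EFinP; exact: measurable_funM.
    rewrite integral_cst// -[X in (_ * X)%E]/(P setT) probability_setT mule1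
      leeD2l//.
    rewrite ge0_integralZl_EFin//; last 2 first.
    - by move=> w _; rewrite lee_fin.
    - exact/measurable_EFinP.
    by rewrite lee_wpmul2l.
  apply: (@le_trans _ _ (\int[P]_w (2%:E * (step_integral (S n) B t w ^+ 2)%:E +
      2%:E * ((step_integral (S n) B t w - I t w) ^+ 2)%:E))%E).
    apply: le_integral_nonmeas => w _; first by rewrite lee_fin sqr_ge0.
    rewrite -!EFinM -EFinD lee_fin.
    by have := sqr_ge0 (2 * step_integral (S n) B t w - I t w); nra.
  have mI' := mI t t0T.
  rewrite ge0_integralD//=; last 4 first.
  - by move=> w _; rewrite -EFinM lee_fin mulr_ge0 ?sqr_ge0.
  - by apply/measurable_EFinP/measurable_funM => //; exact: measurable_funX.
  - by move=> w _; rewrite -EFinM lee_fin mulr_ge0 ?sqr_ge0.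
  - apply/measurable_EFinP/measurable_funM => //; apply: measurable_funX.
    exact: measurable_funB.
  rewrite ge0_integralZl_EFin//; last 2 first.
  - by move=> w _; rewrite lee_fin sqr_ge0.
  - by apply/measurable_EFinP; exact: measurable_funX.
  rewrite ge0_integralZl_EFin//; last 2 first.
  - by move=> w _; rewrite lee_fin sqr_ge0.
  - by apply/measurable_EFinP; apply: measurable_funX; exact: measurable_funB.
  rewrite leeD2r//; apply: le_trans (lee_wpmul2l _ leJ') _ => //.
  rewrite ge0_muleDr ?lee_fin ?mulr_ge0 ?sqr_ge0//; last first.
    by rewrite mule_ge0// integral_ge0// => w _; apply: integral_ge0 => s _;
      rewrite lee_fin sqr_ge0.
  rewrite muleA -!EFinM leeD//.
    by rewrite lee_fin le_eqVlt; apply/orP; left; apply/eqP; ring.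
  apply: lee_wpmul2r; last by rewrite lee_fin -natrM.
  by rewrite integral_ge0// => w _; apply: integral_ge0 => s _;
    rewrite lee_fin sqr_ge0.
have lim : ((32 * M ^+ 2 * t)%:E + 32%:E * eps n +
  2%:E * del n)%E @[n --> \oo] -->
    ((32 * M ^+ 2 * t)%:E + 32%:E * 0 + 2%:E * 0)%E.
  apply: cvgeD; [by rewrite !mule0 !adde0| |].
    apply: cvgeD; [by rewrite mule0|exact: cvg_cst|].
    exact: cvgeZl.
  by apply: cvgeZl => //; exact: cvgI.
rewrite !mule0 !adde0 in lim; rewrite -(cvg_lim _ lim)//.
by apply: lime_ge; [apply/cvg_ex; eexists; exact: lim|exact: nearW].
Qed.

End ItoBound.

(** * Bounds on the Hamiltonian field in the l1 norm *)

Definition l1norm (R : realType) (n : nat) (v : 'cV[R]_n) : R :=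
  \sum_i `|v i 0|.

Lemma l1norm_ge0 (R : realType) (n : nat) (v : 'cV[R]_n) : 0 <= l1norm v.
Proof. exact: sumr_ge0. Qed.

Lemma line_increment_le (R : realType) (n : nat) (f : 'cV[R]_n -> R)
    (i : 'I_n) (M : R) (z : 'cV[R]_n) (h : R) :
  (forall x, derivable f x (delta_mx i 0)) ->
  (forall x, `|partial i f x| <= M) ->
  `|f (z + h *: delta_mx i 0) - f z| <= M * `|h|.
Proof.
move=> df fM; set e := delta_mx i 0.
pose phi (s : R) := f (z + s *: e).
have dphi (s : R) : is_derive s (1 : R) phi (partial i f (z + s *: e)).
  have E : (fun r : R => r^-1 *: ((phi \o shift s) (r *: 1) - phi s)) =
      (fun r : R => r^-1 *: ((f \o shift (z + s *: e)) (r *: e) - f (z +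
        s *: e))).
    apply/funext => r; rewrite /phi /= /shift /=; congr (_ *: (f _ - _)).
    by rewrite (_ : r%:A = r) ?scalerDl 1?addrCA// /GRing.scale/= mulr1.
  apply: DeriveDef; first by rewrite /derivable E; exact: df.
  by rewrite /derive E.
have cphi (a b : R) : {within `[a, b], continuous phi}.
  apply: continuous_subspaceT => s; apply: differentiable_continuous.
  by apply/derivable1_diffP; case: (dphi s).
have -> : f z = phi 0 by rewrite /phi scale0r addr0.
rewrite -[f _]/(phi h).
case: (ltgtP h 0) => [h0|h0|->]; last by rewrite subrr !normr0 mulr0.
  have [c _ E] := MVT h0 (fun s _ => dphi s) (cphi h 0).
  by rewrite distrC E sub0r normrM normrN ler_wpM2r.
have [c _ E] := MVT h0 (fun s _ => dphi s) (cphi 0 h).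
by rewrite E subr0 normrM ler_wpM2r.
Qed.

(** Only derivatives along the axes are given, so [y] is moved to [x] one coordinate at a time:
    [z k] has the first k coordinates of [x] and the others of [y]. *)
Lemma partial_bounded_lipschitz (R : realType) (n : nat) (f : 'cV[R]_n -> R)
    (M : R) (x y : 'cV[R]_n) :
  (forall i x, derivable f x (delta_mx i 0)) ->
  (forall i x, `|partial i f x| <= M) ->
  `|f x - f y| <= M * l1norm (x - y).
Proof.
move=> df fM.
pose z (k : nat) : 'cV[R]_n := \col_i if (i < k)%N then x i 0 else y i 0.
have z0 : z 0%N = y by apply/matrixP => i j; rewrite !mxE ord1.
have zn : z n = x by apply/matrixP => i j; rewrite !mxE ord1 ltn_ord.
have zS (i : 'I_n) : z i.+1 = z i + (x i 0 - y i 0) *: delta_mx i 0.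
  apply/matrixP => k j; rewrite !mxE ord1 eqxx andbT ltnS leq_eqVlt val_eqE.
  by case: eqVneq => [->|_] /=;
    [rewrite ltnn mulr1 addrC subrK|rewrite mulr0 addr0].
rewrite -{1}zn -{1}z0 -(telescope_sumr (fun k => f (z k)) (leq0n n)) big_mkord.
rewrite (le_trans (ler_norm_sum _ _ _))// mulr_sumr ler_sum// => i _.
by rewrite zS !mxE; apply: line_increment_le.
Qed.

Lemma partial_lincomb (R : realType) (n : nat) (a : 'I_n -> R)
    (g : 'I_n -> 'cV[R]_n -> R) (j : 'I_n) :
  (forall k x, derivable (g k) x (delta_mx j 0)) ->
  partial j (fun x => \sum_k a k * g k x) =
  (fun x => \sum_k a k * partial j (g k) x).
Proof.
move=> dg; apply/funext => x; rewrite /partial.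
have -> : (fun x => \sum_k a k * g k x) = \sum_k (a k \*: g k).
  by apply/funext => y; rewrite fct_sumE.
rewrite derive_sum; last by move=> k; exact: derivableZ.
by apply: eq_bigr => k _; rewrite deriveZ.
Qed.

Lemma ham_field_bounds (R : realType) (d : nat) (H : 'cV[R]_(d + d) -> R)
    (x0 : 'cV[R]_(d + d)) :
  class_C 4 H -> bounded_derivatives 2 H -> bounded_derivatives 3 H ->
  exists L K b0 : R, [/\ [/\ 0 <= L, 0 <= K & 0 <= b0],
    forall x i j, `|Jac (ham_field H) x i j| <= L,
    forall x i j k,
      `|partial i (partial j (fun y => ham_field H y k 0)) x| <= K &
    forall x, l1norm (ham_field H x) <= b0 + L * l1norm (x - x0)].
Proof.
move=> hC [M2 hM2] [M3 hM3].
pose J := symplectic_J R d.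
pose g (k : 'I_(d + d)) := partial k H.
have dg k j x : derivable (g k) x (delta_mx j 0).
  by have [_ /(_ isT)] := hC [:: k] isT; exact.
have ddg l k j x : derivable (partial l (g k)) x (delta_mx j 0).
  by have [_ /(_ isT)] := hC [:: l; k] isT; exact.
have bg k j x : `|partial j (g k) x| <= M2 by exact: (hM2 [:: j; k]).
have bdg k l j x : `|partial l (partial j (g k)) x| <= M3 by exact: (hM3 [:: l;
  j; k]).
have hamE i : (fun y => ham_field H y i 0) = fun y => \sum_k J i k * g k y.
  by apply/funext => y; rewrite !mxE; apply: eq_bigr => k _; rewrite !mxE.
have lincomb_le (a c : 'I_(d + d) -> R) (M : R) : (forall k, `|c k| <= M) ->
    `|\sum_k a k * c k| <= (\sum_k `|a k|) * `|M|.
  move=> cM; rewrite (le_trans (ler_norm_sum _ _ _))// mulr_suml ler_sum// =>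
    k _.
  by rewrite normrM ler_wpM2l// (le_trans (cM k))// ler_norm.
pose A := \sum_i \sum_k `|J i k|.
have A0 : 0 <= A by apply: sumr_ge0 => i _; exact: sumr_ge0.
have rowA i : \sum_k `|J i k| <= A.
  by rewrite /A [leRHS](bigD1 i)//= lerDl; apply: sumr_ge0 => ? _;
    exact: sumr_ge0.
have dE i j x : partial j (fun y => ham_field H y i 0) x =
    \sum_k J i k * partial j (g k) x.
  by rewrite hamE partial_lincomb.
(* The factor d + d pays for summing the coordinatewise Lipschitz bounds into an l1 bound; the same
   constant then also bounds the entries of the Jacobian. Absolute values make the constants
   nonnegative whatever bounds M2 and M3 are given. *)
exists ((d + d)%:R * (A * `|M2|)), (A * `|M3|), (l1norm (ham_field H x0));
  split.
- by split; rewrite ?mulr_ge0// l1norm_ge0.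
- move=> x i j; rewrite mxE dE (le_trans (lincomb_le _ _ M2 _))//.
  apply: (@le_trans _ _ (A * `|M2|)); first by rewrite ler_wpM2r.
  by rewrite ler_peMl ?mulr_ge0// ler1n (leq_ltn_trans _ (ltn_ord i)).
- move=> x i j k; rewrite (_ : partial j _ = fun x =>
    \sum_l J k l * partial j (g l) x).
    by rewrite partial_lincomb// (le_trans (lincomb_le _ _ M3 _))// ler_wpM2r.
  by apply/funext => y; exact: dE.
- move=> x.
  have comp i : `|ham_field H x i 0 - ham_field H x0 i 0| <=
    A * `|M2| * l1norm (x - x0).
    apply: (partial_bounded_lipschitz (f := fun y => ham_field H y i 0)).
      move=> j y; rewrite hamE.
      rewrite (_ : (fun y => _) = \sum_k (J i k \*: g k));
        last by apply/funext => z; rewrite fct_sumE.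
      by apply: derivable_sum => k; exact: derivableZ.
    move=> j y; rewrite dE (le_trans (lincomb_le _ _ M2 _))//.
    by rewrite ler_wpM2r.
  have -> : (d + d)%:R * (A * `|M2|) * l1norm (x - x0) =
      \sum_(i < d + d) A * `|M2| * l1norm (x - x0).
    by rewrite sumr_const card_ord -mulrA mulr_natl.
  rewrite {1 2}/l1norm -big_split/=.
  apply: ler_sum => i _; rewrite -lerBlDl (le_trans _ (comp i))//.
  by rewrite (le_trans (lerB_dist _ _)).
Qed.

(** * Time integrals of continuous paths *)

Section Segment.
Context (R : realType).
Implicit Types (f g : R -> R) (t a c : R).

Lemma segment_integrable f t : {within `[0, t], continuous f} ->
  lebesgue_measure.-integrable `[0, t] (EFin \o f).
Proof.
by move=> cf; apply: continuous_compact_integrable => //;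
  exact: segment_compact.
Qed.

Lemma within_continuous_affine f (A : set R) a c : {within A, continuous f} ->
  {within A, continuous (fun s => a + c * f s)}.
Proof.
move=> cf s; apply: cvgD; first exact: cvg_cst.
by apply: cvgM; [exact: cvg_cst|exact: cf].
Qed.

Lemma within_continuous_sum (A : set R) (n : nat) (f : 'I_n -> R -> R) :
  (forall i, {within A, continuous (f i)}) ->
  {within A, continuous (fun s => \sum_i f i s)}.
Proof.
elim: n f => [|n IH] f cf.
  rewrite (_ : (fun s => _) = cst 0); first by move=> s; exact: cvg_cst.
  by apply/funext => s; rewrite big_ord0.
rewrite (_ : (fun s => _) = fun s =>
  \sum_(i < n) f (widen_ord (leqnSn n) i) s + f ord_max s); last first.
  by apply/funext => s; rewrite big_ord_recr.
move=> s; apply: cvgD; last exact: cf.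
by apply: (IH (fun i => f (widen_ord (leqnSn n) i))) => i; exact: cf.
Qed.

Lemma within_continuous_l1norm (A : set R) (n : nat) (v : R -> 'cV[R]_n) :
  (forall i, {within A, continuous (fun s => v s i 0)}) ->
  {within A, continuous (fun s => l1norm (v s))}.
Proof.
move=> cv; apply: within_continuous_sum => i s; apply: cvg_norm; exact: cv.
Qed.

Lemma Rintegral_segment_affine f t a c : 0 <= t ->
  {within `[0, t], continuous f} ->
  \int[lebesgue_measure]_(s in `[0, t]) (a + c * f s) =
  a * t + c * \int[lebesgue_measure]_(s in `[0, t]) f s.
Proof.
move=> t0 cf.
have ccst : {within `[0, t], continuous (cst a : R -> R)} by move=> s;
  exact: cvg_cst.
have cZ : {within `[0, t], continuous (fun s => c * f s)}.
  by move=> s; apply: cvgM; [exact: cvg_cst|exact: cf].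
rewrite (RintegralD _ (segment_integrable ccst) (segment_integrable cZ))//.
rewrite RintegralZl//; last exact: segment_integrable.
congr (_ + _); rewrite [LHS](Rintegral_cst lebesgue_measure)//; congr (_ * _).
rewrite [X in fine X]lebesgue_measure_itv/= lte_fin; move: t0.
by rewrite le_eqVlt => /predU1P[<-|t0]; rewrite ?ltxx ?t0//= subr0.
Qed.

Lemma Rintegral_segment_mono f s t : 0 <= s <= t ->
  {within `[0, t], continuous f} -> (forall r, 0 <= r <= t -> 0 <= f r) ->
  \int[lebesgue_measure]_(r in `[0, s]) f r <=
  \int[lebesgue_measure]_(r in `[0, t]) f r.
Proof.
move=> /andP[s0 st] cf f0.
have sub : `[0, s] `<=` `[0, t] by apply: subset_itv; rewrite bnd_simp.
have fit := segment_integrable cf.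
have fis : lebesgue_measure.-integrable `[0, s] (EFin \o f).
  by apply: integrableS fit.
apply: fine_le; [exact: integrable_fin_num|exact: integrable_fin_num|].
by apply: ge0_subset_integral => //; exact: measurable_int fit.
Qed.

Lemma l1norm_time_integral_le (n : nat) (v : R -> 'cV[R]_n) g t :
  {within `[0, t], continuous g} ->
  (forall s i, 0 <= s <= t -> `|v s i 0| <= g s) ->
  l1norm (time_integral t v) <=
  n%:R * \int[lebesgue_measure]_(s in `[0, t]) g s.
Proof.
move=> cg vg; rewrite -[n in n%:R]card_ord mulr_natl -sumr_const ler_sum// =>
  i _.
rewrite mxE le_normr_Rintegral_nonmeas//; first exact: segment_integrable.
by move=> s; rewrite /= in_itv/=; exact: vg.
Qed.

End Segment.

Lemma l1normD (R : realType) (n : nat) (u v : 'cV[R]_n) :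
  l1norm (u + v) <= l1norm u + l1norm v.
Proof. by rewrite -big_split ler_sum// => i _; rewrite mxE ler_normD. Qed.

Lemma l1normZ (R : realType) (n : nat) (c : R) (v : 'cV[R]_n) :
  l1norm (c *: v) = `|c| * l1norm v.
Proof. by rewrite mulr_sumr; apply: eq_bigr => i _; rewrite mxE normrM. Qed.

Lemma l1norm_sum (R : realType) (n m : nat) (v : 'I_m -> 'cV[R]_n) :
  l1norm (\sum_k v k) <= \sum_k l1norm (v k).
Proof.
rewrite exchange_big ler_sum// => i _; rewrite summxE; exact: ler_norm_sum.
Qed.

Lemma mulmx_entry_le (R : realType) (n : nat) (A : 'M[R]_n) (v : 'cV[R]_n)
    (L : R) (i : 'I_n) : (forall i j, `|A i j| <= L) ->
  `|(A *m v) i 0| <= L * l1norm v.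
Proof.
move=> AL; rewrite mxE (le_trans (ler_norm_sum _ _ _))// mulr_sumr ler_sum// =>
  j _.
by rewrite normrM ler_wpM2r.
Qed.

(** * Gronwall estimates along one path *)

Section PathBounds.
Context (R : realType) (n : nat) (t : R) (t0 : 0 <= t).
Context (x I0 : R -> 'cV[R]_n) (x0 : 'cV[R]_n) (b : 'cV[R]_n -> 'cV[R]_n).
Context (b0 L : R) (b0_ge0 : 0 <= b0) (L_ge0 : 0 <= L).
Context (cx : forall i, {within `[0, t], continuous (fun s => x s i 0)}).
Context (cI0 : forall i, {within `[0, t], continuous (fun s => I0 s i 0)}).
Context (b_le : forall y, l1norm (b y) <= b0 + L * l1norm (y - x0)).
Context (xE : forall s, 0 <= s <= t ->
  x s = x0 + time_integral s (fun r => b (x r)) + I0 s).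

Let N : R := n%:R.
Let y s := l1norm (x s - x0).

Let N_ge0 : 0 <= N. Proof. exact: ler0n. Qed.

Let sub s : s <= t -> `[0, s] `<=` `[0, t].
Proof. by move=> st; apply: subset_itv; rewrite bnd_simp. Qed.

Let cy : {within `[0, t], continuous y}.
Proof.
apply: within_continuous_l1norm => i.
rewrite (_ : (fun s => _) = fun s => - x0 i 0 + 1 * x s i 0).
  exact: within_continuous_affine.
by apply/funext => s; rewrite !mxE mul1r addrC.
Qed.

Let cN0 : {within `[0, t], continuous (fun s => l1norm (I0 s))}.
Proof. exact: within_continuous_l1norm. Qed.

Lemma sde_path_le :
  \int[lebesgue_measure]_(s in `[0, t]) l1norm (x s - x0) <=
  expR (n%:R * L * t) * (n%:R * b0 * t * t +
    \int[lebesgue_measure]_(s in `[0, t]) l1norm (I0 s)).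
Proof.
(* The drift at [x0] is bounded by its value at the final time [t], so the forcing is a constant
   plus the noise; the factor [1 *] puts it into the form of [Rintegral_segment_affine]. *)
have H s : 0 <= s <= t -> y s <= (N * b0 * t + 1 * l1norm (I0 s)) +
    N * L * \int[lebesgue_measure]_(r in `[0, s]) y r.
  move=> /andP[s0 st].
  have cys : {within `[0, s], continuous y} := continuous_subspaceW (sub st) cy.
  rewrite /y xE ?s0// addrC addrA addKr (le_trans (l1normD _ _))//.
  have H1 : l1norm (time_integral s (fun r => b (x r))) <=
      N * (b0 * s + L * \int[lebesgue_measure]_(r in `[0, s]) y r).
    rewrite -(Rintegral_segment_affine b0 L s0 cys).
    apply: l1norm_time_integral_le; first exact: within_continuous_affine.
    move=> r i _; apply: le_trans (b_le (x r)).
    by rewrite /l1norm (bigD1 i)//= lerDl sumr_ge0.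
  have : N * b0 * s <= N * b0 * t by rewrite ler_wpM2l// mulr_ge0.
  by move: H1; rewrite -/y; lra.
have ca : {within `[0, t], continuous (fun s =>
  N * b0 * t + 1 * l1norm (I0 s))}.
  exact: within_continuous_affine.
have := le_Rintegral_gronwall (mulr_ge0 N_ge0 L_ge0) t0 cy ca _ H.
rewrite Rintegral_segment_affine// mul1r; apply => s _.
by rewrite mul1r addr_ge0 ?l1norm_ge0// !mulr_ge0.
Qed.

Context (m : nat) (sigma : 'M[R]_(n, m)) (K : R) (K_ge0 : 0 <= K).
Context (Jac_le : forall z i j, `|Jac b z i j| <= L).
Context (D2_le : forall z i j k,
  `|partial i (partial j (fun y => b y k 0)) z| <= K).
Context (u I1 I2 : R -> 'cV[R]_n) (c1 c2 c3 : R).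
Context (cu : forall i, {within `[0, t], continuous (fun s => u s i 0)}).
Context (cI1 : forall i, {within `[0, t], continuous (fun s => I1 s i 0)}).
Context (cI2 : forall i, {within `[0, t], continuous (fun s => I2 s i 0)}).
Context (uE : forall s, 0 <= s <= t -> u s =
  time_integral s (fun r => Jac b (x r) *m u r) +
  c1 *: time_integral s (fun r => Jac b (x r) *m b (x r)) +
  c1 *: I1 s + c2 *: I2 s +
  c3 *: \sum_(k < m) time_integral s (fun r =>
    D2 b (x r) (col k sigma) (col k sigma))).

Let Sigma : R := \sum_k \sum_i \sum_j `|sigma i k| * `|sigma j k|.

Let Y : R := \int[lebesgue_measure]_(s in `[0, t]) y s.

Let Sigma_ge0 : 0 <= Sigma.
Proof.
by do 3 (apply: sumr_ge0 => ? _); rewrite mulr_ge0.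
Qed.

Let D2_entry_le z k i :
  `|D2 b z (col k sigma) (col k sigma) i 0| <= K * Sigma.
Proof.
rewrite mxE (le_trans (ler_norm_sum _ _ _))//.
apply: (@le_trans _ _ (K * \sum_i \sum_j `|sigma i k| * `|sigma j k|));
  last first.
  rewrite ler_wpM2l// /Sigma [leRHS](bigD1 k)//= lerDl.
  by do 3 (apply: sumr_ge0 => ? _); rewrite mulr_ge0.
rewrite mulr_sumr ler_sum// => j _.
rewrite (le_trans (ler_norm_sum _ _ _))// mulr_sumr ler_sum// => l _.
by rewrite !normrM !mxE -mulrA ler_wpM2r ?mulr_ge0.
Qed.

(** Apart from the two Ito integrals, the forcing is frozen at time [t]: the part due to [b]
    involves the path of X only through its integral [Y] over the whole segment, a constant for the
    Gronwall argument in [s]. *)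
Let forcing_le s : 0 <= s <= t ->
  l1norm (u s) <= (`|c1| * (N * L * (b0 * t + L * Y)) +
    `|c3| * (m%:R * (N * (K * Sigma) * t))
    + 1 * (`|c1| * l1norm (I1 s) + `|c2| * l1norm (I2 s)))
    + N * L * \int[lebesgue_measure]_(r in `[0, s]) l1norm (u r).
Proof.
move=> /andP[s0 st].
have cys : {within `[0, s], continuous y} := continuous_subspaceW (sub st) cy.
have cus : {within `[0, s], continuous (fun r => l1norm (u r))}.
  by apply: continuous_subspaceW (sub st) _; exact: within_continuous_l1norm.
have Hu : l1norm (time_integral s (fun r => Jac b (x r) *m u r)) <=
    N * (0 * s + L * \int[lebesgue_measure]_(r in `[0, s]) l1norm (u r)).
  rewrite -(Rintegral_segment_affine 0 L s0 cus).
  apply: l1norm_time_integral_le; first exact: within_continuous_affine.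
  by move=> r i _; rewrite add0r mulmx_entry_le.
have Hb : l1norm (time_integral s (fun r => Jac b (x r) *m b (x r))) <=
    N * (L * b0 * s + L * L * \int[lebesgue_measure]_(r in `[0, s]) y r).
  rewrite -(Rintegral_segment_affine (L * b0) (L * L) s0 cys).
  apply: l1norm_time_integral_le; first exact: within_continuous_affine.
  move=> r i _; apply: le_trans (mulmx_entry_le _ _ (Jac_le (x r))) _.
  by rewrite -!mulrA -mulrDr ler_wpM2l.
have Hb' : l1norm (time_integral s (fun r => Jac b (x r) *m b (x r))) <=
    N * L * (b0 * t + L * Y).
  apply: le_trans Hb _.
  have YS : \int[lebesgue_measure]_(r in `[0, s]) y r <= Y.
    by apply: Rintegral_segment_mono => //; rewrite ?s0// => r _;
      exact: l1norm_ge0.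
  rewrite (_ : N * _ = N * L * (b0 * s + L * \int[lebesgue_measure]_(r in `[0,
    s]) y r)).
    by rewrite ler_wpM2l ?mulr_ge0// lerD// ler_wpM2l.
  by ring.
have HD : l1norm (\sum_(k < m) time_integral s (fun r =>
    D2 b (x r) (col k sigma) (col k sigma))) <= m%:R * (N * (K * Sigma) * t).
  rewrite (le_trans (l1norm_sum _))//
    -[m in m%:R]card_ord mulr_natl -sumr_const.
  apply: ler_sum => k _; apply: (@le_trans _ _ (N * (K * Sigma * s + 0 * 0))).
    have c0 : {within `[0, s], continuous (cst 0 : R -> R)} by move=> r;
      exact: cvg_cst.
    have -> : 0 * 0 = 0 * \int[lebesgue_measure]_(r in `[0,
      s]) (cst 0 r : R) by rewrite !mul0r.
    rewrite -(Rintegral_segment_affine (K * Sigma) 0 s0 c0).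
    apply: l1norm_time_integral_le; first exact: within_continuous_affine.
    by move=> r i _; rewrite mul0r addr0.
  by rewrite mul0r addr0 mulrA ler_wpM2l// !mulr_ge0.
rewrite uE ?s0//.
set T1 := time_integral s _ in Hu *; set T2 := time_integral s _ in Hb' *.
set T3 := \sum_(k < m) _ in HD *.
have h4 := l1normD (T1 + c1 *: T2 + c1 *: I1 s + c2 *: I2 s) (c3 *: T3).
have h3 := l1normD (T1 + c1 *: T2 + c1 *: I1 s) (c2 *: I2 s).
have h2 := l1normD (T1 + c1 *: T2) (c1 *: I1 s).
have h1 := l1normD T1 (c1 *: T2).
rewrite !l1normZ in h1 h2 h3 h4.
have k1 : `|c1| * l1norm T2 <= `|c1| * (N * L * (b0 * t +
  L * Y)) by rewrite ler_wpM2l.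
have k3 : `|c3| * l1norm T3 <=
  `|c3| * (m%:R * (N * (K * Sigma) * t)) by rewrite ler_wpM2l.
rewrite mul0r add0r mulrA in Hu.
lra.
Qed.

(** The integrated Gronwall bound is substituted once into [forcing_le] at time [t]. The constant
    forcing thereby gets the factor 1 + G e t, while each Ito integral appears once at time [t] with
    its bare coefficient and once under the time integral with the factor G e. Inserting
    [sde_path_le] for [Y] brings in the noise [I0] of X. *)
Lemma limit_error_path_le (e := expR (n%:R * L * t)) (G := n%:R * L) :
  l1norm (u t) <=
  `|c1| * ((1 + G * e * t) * G * (b0 * t + L * e * (n%:R * b0 * t * t))) +
  `|c1| * ((1 + G * e * t) * G * L * e) *
     (\int[lebesgue_measure]_(s in `[0, t]) l1norm (I0 s)) +
  `|c3| * ((1 + G * e * t) * (m%:R * n%:R * K *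
     (\sum_k \sum_i \sum_j `|sigma i k| * `|sigma j k|)) * t) +
  `|c1| * l1norm (I1 t) + `|c2| * l1norm (I2 t) +
  `|c1| * (G * e) * (\int[lebesgue_measure]_(s in `[0, t]) l1norm (I1 s)) +
  `|c2| * (G * e) * (\int[lebesgue_measure]_(s in `[0, t]) l1norm (I2 s)).
Proof.
have e0 : 0 <= e := expR_ge0 _.
have G0 : 0 <= G by rewrite mulr_ge0.
pose a0 := `|c1| * (N * L * (b0 * t + L * Y)) +
  `|c3| * (m%:R * (N * (K * Sigma) * t)).
pose f s := `|c1| * l1norm (I1 s) + `|c2| * l1norm (I2 s).
have Y0 : 0 <= Y by apply: Rintegral_ge0 => s _; exact: l1norm_ge0.
have a0_ge0 : 0 <= a0 by rewrite addr_ge0// !mulr_ge0// addr_ge0// mulr_ge0.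
have cN1 := within_continuous_l1norm cI1;
  have cN2 := within_continuous_l1norm cI2.
have cf : {within `[0, t], continuous f}.
  by move=> s; apply: cvgD; (apply: cvgM; first exact: cvg_cst);
    [exact: cN1|exact: cN2].
have ca : {within `[0, t], continuous (fun s =>
  a0 + 1 * f s)} by exact: within_continuous_affine.
have cU : {within `[0, t], continuous (fun s =>
  l1norm (u s))} by exact: within_continuous_l1norm.
have a_ge0 s : 0 <= s <= t -> 0 <= a0 + 1 * f s.
  by move=> _; rewrite mul1r addr_ge0// addr_ge0// mulr_ge0// l1norm_ge0.
have IU := le_Rintegral_gronwall G0 t0 cU ca a_ge0 forcing_le.
rewrite Rintegral_segment_affine// mul1r -/e in IU.
have fE : \int[lebesgue_measure]_(s in `[0, t]) f s =
    `|c1| * (\int[lebesgue_measure]_(s in `[0, t]) l1norm (I1 s)) +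
    `|c2| * (\int[lebesgue_measure]_(s in `[0, t]) l1norm (I2 s)).
  rewrite RintegralD//; last 2 first.
  - by apply: segment_integrable => s; apply: cvgM; [exact: cvg_cst|exact: cN1].
  - by apply: segment_integrable => s; apply: cvgM; [exact: cvg_cst|exact: cN2].
  by rewrite !RintegralZl//; exact: segment_integrable.
have tt : 0 <= t <= t by rewrite t0 lexx.
have Ut := forcing_le tt; rewrite -/a0 mul1r in Ut.
have Yle := sde_path_le; rewrite -/Y -/e in Yle.
have GIU := ler_wpM2l G0 IU.
set i0 := \int[lebesgue_measure]_(s in `[0, t]) l1norm (I0 s) in Yle *.
set i1 := \int[lebesgue_measure]_(s in `[0, t]) l1norm (I1 s) in fE *.
set i2 := \int[lebesgue_measure]_(s in `[0, t]) l1norm (I2 s) in fE *.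
rewrite fE -/Sigma in GIU *.
have h : (1 + G * e * t) * a0 <= (1 + G * e * t) *
    (`|c1| * (G * (b0 * t + L * (e * (n%:R * b0 * t * t + i0)))) +
     `|c3| * (m%:R * (N * (K * Sigma) * t))).
  rewrite ler_wpM2l//; first by rewrite addr_ge0// !mulr_ge0.
  by rewrite lerD2r ler_wpM2l// ler_wpM2l// lerD2l ler_wpM2l.
rewrite /N -/G in Ut h GIU *.
lra.
Qed.

End PathBounds.

Lemma ae_forall_ord (dp : measure_display) (Omega : measurableType dp)
    (R : realType) (P : probability Omega R) (n : nat)
    (Q : 'I_n -> Omega -> Prop) :
  (forall i, {ae P, forall w, Q i w}) -> {ae P, forall w i, Q i w}.
Proof.
move=> aeQ.
(* The finite family is padded to one indexed by [nat], to which countable intersection applies. *)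
have : {ae P, forall w (k : nat), forall i : 'I_n, i = k :> nat -> Q i w}.
  apply: ae_foralln => k; have [kn|nk] := ltnP k n.
    apply: filterS (aeQ (Ordinal kn)) => w Qw i ik.
    by rewrite (_ : i = Ordinal kn)//; exact: val_inj.
  by apply: aeW => w i ik; move: nk; rewrite leqNgt -ik ltn_ord.
by apply: filterS => w Qw i; exact: Qw.
Qed.

(** * Moments of vector-valued Ito integrals *)

Section ItoVector.
Context (dp : measure_display) (Omega : measurableType dp) (R : realType).
Context (P : probability Omega R) (T : R) (F : R -> set (set Omega)).
Context (n m : nat) (h : R -> Omega -> 'M[R]_(n,
  m)) (W : R -> Omega -> 'cV[R]_m).
Context (I : R -> Omega -> 'cV[R]_n).
Context (hF : filtration T F) (hW : brownian_motion P T F W).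
Context (hI : ito_integral_vec P T F h W I).
Context (M : R) (hM : forall i j s w, `|h s w i j| <= M).

(** Cauchy-Schwarz over the n rows and then over the m columns costs n * m, and there remain n * m
    scalar integrals of second moment at most 32 M^2 s. *)
Definition ito_second_moment : R := (n%:R * m%:R) ^+ 2 * (32 * M ^+ 2).

Lemma ito_second_moment_ge0 : 0 <= ito_second_moment.
Proof. by rewrite mulr_ge0 ?sqr_ge0// mulr_ge0 ?sqr_ge0. Qed.

Lemma ito_integral_vec_continuous :
  {ae P, forall w i, {within `[0, T], continuous (fun s => I s w i 0)}}.
Proof.
have [K [hK IE]] := hI.
have : {ae P, forall w i j, {within `[0, T], continuous (fun s => K i j s w)}}.
  by apply: ae_forall_ord => i; apply: ae_forall_ord => j; have [] := hK i j.
apply: filterS => w cK i; rewrite (_ : (fun s => _) = fun s =>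
  \sum_j K i j s w).
  by apply: within_continuous_sum => j; exact: cK.
by apply/funext => s; rewrite IE mxE.
Qed.

Lemma ito_integral_vec_measurable s : 0 <= s <= T ->
  measurable_fun setT (fun w => l1norm (I s w)).
Proof.
have [K [hK IE]] := hI => sT.
apply: measurable_sum => i; apply: measurableT_comp => //.
rewrite (_ : (fun w => _) = fun w => \sum_j K i j s w).
  by apply: measurable_sum => j; have [mK _ _] := hK i j; exact: mK.
by apply/funext => w; rewrite IE mxE.
Qed.

Lemma ito_integral_vec_sqr_le s : 0 <= s <= T ->
  (\int[P]_w (l1norm (I s w) ^+ 2)%:E <= (ito_second_moment * s)%:E)%E.
Proof.
have [K [hK IE]] := hI => sT.
have eK i j : expectation_below P (fun w => K i j s w ^+ 2) (32 * M ^+ 2 * s).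
  apply: expectation_below_integral => [|w|].
  - by apply: measurable_funX; have [mK _ _] := hK i j; exact: mK.
  - exact: sqr_ge0.
  - apply: (ito_integral_sqr_le hF (brownian_gaussian_increments j hW) (hK i
      j)) => //.
apply: integral_expectation_below => [|w|].
- by apply: measurable_funX; exact: ito_integral_vec_measurable.
- exact: sqr_ge0.
have eS : expectation_below P
    (fun w => n%:R * \sum_i (m%:R * \sum_j K i j s w ^+ 2))
    (n%:R * \sum_(i < n) (m%:R * \sum_(j < m) 32 * M ^+ 2 * s)).
  apply: expectation_belowZ => //; apply: expectation_below_sum => i.
  by apply: expectation_belowZ => //; apply: expectation_below_sum => j.
have momentE : n%:R * \sum_(i < n) (m%:R * \sum_(j < m) 32 * M ^+ 2 * s) =
    ito_second_moment * s.
  rewrite !sumr_const !card_ord -(mulr_natl _ m) -(mulr_natl _ n).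
  by rewrite /ito_second_moment; ring.
rewrite momentE in eS; apply: expectation_below_le eS.
apply: aeW => w; rewrite /l1norm (le_trans (sqr_sum_le _))// ler_wpM2l//
  ler_sum// => i _.
by rewrite real_normK ?num_real// IE mxE;
  exact: (sqr_sum_le (fun j => K i j s w)).
Qed.

Lemma ito_integral_vec_Rintegral_below t : 0 <= t <= T ->
  expectation_below P
    (fun w => (\int[lebesgue_measure]_(s in `[0, t]) l1norm (I s w)) ^+ 2)
    (t ^+ 2 * (ito_second_moment * t)).
Proof.
move=> /andP[t0 tT].
have le_T s : 0 <= s <= t -> 0 <= s <= T.
  by move=> /andP[-> st]; exact: le_trans tT.
apply: (expectation_below_sqr_Rintegral (g := fun s w => l1norm (I s w))) => //.
- by move=> s st; apply: ito_integral_vec_measurable; exact: le_T.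
- apply: filterS ito_integral_vec_continuous => w cI.
  apply: continuous_subspaceW (within_continuous_l1norm cI).
  by apply: subset_itv; rewrite bnd_simp.
- move=> s st; apply: le_trans (ito_integral_vec_sqr_le (le_T _ st)) _.
  rewrite lee_fin ler_wpM2l//; last by case/andP: st.
  exact: ito_second_moment_ge0.
Qed.

End ItoVector.

(** * Collecting constants and powers of T *)

(* [E = exp ((G + 1) t)] dominates [1], [t], [e] and [e t], so that every
   remaining factor is a constant times a power at most 5 of [E]. *)
Lemma moment_constants_le (R : realType) (t T G L N b0 kappa K theta : R)
    (c1 := (1 - 2 * theta) * T / 2) (c2 := Num.sqrt 3 / 6 * T)
    (c3 := (1 - 2 * theta ^+ 2) * T / 4) (e := expR (G * t)) :
  0 <= t <= T -> 0 <= G -> 0 <= L -> 0 <= N -> 0 <= b0 -> 0 <= kappa -> 0 <=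
    K ->
  7 * ((`|c1| * ((1 + G * e * t) * G * (b0 * t +
    L * e * (N * b0 * t * t)))) ^+ 2 +
    (`|c1| * ((1 + G * e * t) * G * L * e)) ^+ 2 * (t ^+ 2 * (kappa * t)) +
    (`|c3| * ((1 + G * e * t) * K * t)) ^+ 2 +
    c1 ^+ 2 * (kappa * t) + c2 ^+ 2 * (kappa * t) +
    (`|c1| * (G * e)) ^+ 2 * (t ^+ 2 * (kappa * t)) +
    (`|c2| * (G * e)) ^+ 2 * (t ^+ 2 * (kappa * t))) <=
  expR (5 * (G + 1) * t) *
    (7 / 4 * (((1 + G) * G * b0 * (1 + L * N)) ^+ 2 +
        kappa * ((1 + G) * G * L) ^+ 2) * (1 - 2 * theta) ^+ 2 * T ^+ 4
     + 7 * kappa * (1 + G ^+ 2) * (theta ^+ 2 - theta + 3^-1) * T ^+ 3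
     + 7 / 16 * ((1 + G) * K) ^+ 2 * (1 - 2 * theta ^+ 2) ^+ 2 * T ^+ 2).
Proof.
move=> /andP[t0 tT] G0 L0 N0 b00 k0 K0.
have T0 : 0 <= T := le_trans t0 tT.
pose E := expR ((G + 1) * t).
have E5 : expR (5 * (G + 1) * t) = E ^+ 5 by rewrite /E -mulrA -expRM_natl.
have e0 : 0 <= e := expR_ge0 _.
have e1 : 1 <= e by rewrite -expR0 ler_expR mulr_ge0.
have q1 : 1 + t <= expR t := expR_ge1Dx t.
have Eeq : E = e * expR t by rewrite /E mulrDl mul1r expRD.
have etE : e * t <= E by rewrite Eeq ler_wpM2l//; lra.
have eE : e <= E by rewrite Eeq ler_peMr//; lra.
have E1 : 1 <= E by apply: le_trans eE.
have E0 : 0 <= E by apply: le_trans E1.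
have tE : t <= E by apply: le_trans etE; rewrite ler_peMl.
have et0 : 0 <= e * t by rewrite mulr_ge0.
have a1 : 0 <= 1 + G * e * t <= (1 + G) * E.
  have : G * (e * t) <= G * E by rewrite ler_wpM2l.
  have : 0 <= G * (e * t) by rewrite mulr_ge0.
  by rewrite mulrA; lra.
have a2 : 0 <= 1 + L * N * (e * t) <= (1 + L * N) * E.
  have : L * N * (e * t) <= L * N * E by rewrite ler_wpM2l// mulr_ge0.
  have : 0 <= L * N * (e * t) by rewrite !mulr_ge0.
  by lra.
have c1E : `|c1| ^+ 2 = (1 - 2 * theta) ^+ 2 * T ^+ 2 / 4.
  by rewrite real_normK ?num_real// /c1; field.
have c3E : `|c3| ^+ 2 = (1 - 2 * theta ^+ 2) ^+ 2 * T ^+ 2 / 16.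
  by rewrite real_normK ?num_real// /c3; field.
have c12E : c1 ^+ 2 + c2 ^+ 2 = (theta ^+ 2 - theta + 3^-1) * T ^+ 2.
  by rewrite /c1 /c2 !exprMn sqr_sqrtr//; field.
have sq0 (x : R) : 0 <= x ^+ 2 := sqr_ge0 x.
have powE k : (k <= 5)%N -> E ^+ k <= E ^+ 5 by move=> k5; rewrite ler_weXn2l.
have t2 : t ^+ 2 <= T ^+ 2 by rewrite lerXn2r// nnegrE.
have sqle (x y : R) : 0 <= x <= y -> x ^+ 2 <= y ^+ 2.
  by move=> /andP[x0 xy]; rewrite lerXn2r// nnegrE// (le_trans x0).
have mulle (x x' y y' : R) : 0 <= x <= x' -> 0 <= y <= y' -> 0 <= x * y <=
  x' * y'.
  by move=> /andP[x0 xx'] /andP[y0 yy']; rewrite mulr_ge0//= ler_pM.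
have E0E : 0 <= E <= E by rewrite E0 lexx.
have t0E : 0 <= t <= E by rewrite t0.
have e0E : 0 <= e <= E by rewrite e0.
(* The factor t^2 is kept, since together with the T^2 of c1^2 it makes T^4; the two remaining
   factors are each at most a constant times [E]. *)
have le1 : (`|c1| * ((1 + G * e * t) * G * (b0 * t +
  L * e * (N * b0 * t * t)))) ^+ 2 <=
    `|c1| ^+ 2 * t ^+ 2 * ((1 + G) * G * b0 * (1 + L * N)) ^+ 2 * E ^+ 5.
  apply: (@le_trans _ _ (`|c1| ^+ 2 * t ^+ 2 * ((1 + G) * G * b0 * (1 +
    L * N)) ^+ 2 * E ^+ 4)).
    have -> : (`|c1| * ((1 + G * e * t) * G * (b0 * t +
      L * e * (N * b0 * t * t)))) ^+ 2 =
      `|c1| ^+ 2 * t ^+ 2 * (G * b0) ^+ 2 *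
       ((1 + G * e * t) * (1 + L * N * (e * t))) ^+ 2 by ring.
    have -> : `|c1| ^+ 2 * t ^+ 2 * ((1 + G) * G * b0 * (1 +
      L * N)) ^+ 2 * E ^+ 4 =
      `|c1| ^+ 2 * t ^+ 2 * (G * b0) ^+ 2 *
       ((1 + G) * E * ((1 + L * N) * E)) ^+ 2 by ring.
    by rewrite ler_wpM2l ?mulr_ge0// sqle// mulle.
  by apply: ler_wpM2l; [rewrite !(sq0, mulr_ge0)|exact: powE].
(* Of the t^3 in the moment of the integrated noise of X, t^2 is kept for T^4 and the third factor
   is absorbed: this is where the fifth power of [E] is reached. *)
have le2 : (`|c1| * ((1 + G * e * t) * G * L * e)) ^+ 2 * (t ^+ 2 * (kappa *
  t)) <=
    `|c1| ^+ 2 * t ^+ 2 * (kappa * ((1 + G) * G * L) ^+ 2) * E ^+ 5.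
  have -> : (`|c1| * ((1 + G * e * t) * G * L * e)) ^+ 2 * (t ^+ 2 * (kappa *
    t)) =
    `|c1| ^+ 2 * t ^+ 2 * (kappa * (G * L) ^+ 2) *
      (((1 + G * e * t) * e) ^+ 2 * t) by ring.
  have -> : `|c1| ^+ 2 * t ^+ 2 * (kappa * ((1 + G) * G * L) ^+ 2) * E ^+ 5 =
    `|c1| ^+ 2 * t ^+ 2 * (kappa * (G * L) ^+ 2) *
      (((1 + G) * E * E) ^+ 2 * E) by ring.
  by rewrite ler_wpM2l ?mulr_ge0// ler_pM// sqle// mulle.
(* Here [t] is absorbed entirely, so that T^2 comes from c3^2 alone. *)
have le3 : (`|c3| * ((1 + G * e * t) * K * t)) ^+ 2 <=
    `|c3| ^+ 2 * ((1 + G) * K) ^+ 2 * E ^+ 5.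
  apply: (@le_trans _ _ (`|c3| ^+ 2 * ((1 + G) * K) ^+ 2 * E ^+ 4)).
    have -> : (`|c3| * ((1 + G * e * t) * K * t)) ^+ 2 =
      `|c3| ^+ 2 * K ^+ 2 * ((1 + G * e * t) * t) ^+ 2 by ring.
    have -> : `|c3| ^+ 2 * ((1 + G) * K) ^+ 2 * E ^+ 4 =
      `|c3| ^+ 2 * K ^+ 2 * ((1 + G) * E * E) ^+ 2 by ring.
    by rewrite ler_wpM2l ?mulr_ge0// sqle// mulle.
  by apply: ler_wpM2l; [rewrite !(sq0, mulr_ge0)|exact: powE].
(* A single factor t <= T is kept, which turns the T^2 of c1^2 + c2^2 into T^3; the time integrals
   of the noises contribute (e t)^2 <= E^2 beyond it. *)
have le4 : (c1 ^+ 2 + c2 ^+ 2) * (kappa * t * (1 + (G * (e * t)) ^+ 2)) <=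
    (c1 ^+ 2 + c2 ^+ 2) * (kappa * T * ((1 + G ^+ 2) * E ^+ 5)).
  rewrite ler_wpM2l ?addr_ge0// ler_pM// ?mulr_ge0// ?addr_ge0//.
    by rewrite ler_wpM2l.
  apply: (@le_trans _ _ ((1 + G ^+ 2) * E ^+ 2)); last first.
    by apply: ler_wpM2l; [rewrite addr_ge0 ?sq0|exact: powE].
  have : (e * t) ^+ 2 <= E ^+ 2 by rewrite lerXn2r// nnegrE.
  move=> /(ler_wpM2l (sq0 G)); rewrite exprMn.
  have : 1 <= E ^+ 2 by rewrite exprn_ege1.
  by lra.
have le12 : `|c1| ^+ 2 * t ^+ 2 * (((1 + G) * G * b0 * (1 + L * N)) ^+ 2 +
      kappa * ((1 + G) * G * L) ^+ 2) * E ^+ 5 <=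
    (1 - 2 * theta) ^+ 2 * T ^+ 4 / 4 * (((1 + G) * G * b0 * (1 + L * N)) ^+ 2 +
      kappa * ((1 + G) * G * L) ^+ 2) * E ^+ 5.
  apply: ler_wpM2r; first exact: exprn_ge0.
  apply: ler_wpM2r; first by rewrite addr_ge0// ?(sq0, mulr_ge0).
  rewrite c1E.
  have -> : (1 - 2 * theta) ^+ 2 * T ^+ 4 / 4 =
    (1 - 2 * theta) ^+ 2 * T ^+ 2 / 4 * T ^+ 2 by field.
  by apply: ler_wpM2l => //; rewrite !(sq0, mulr_ge0)// invr_ge0.
have sum4 : c1 ^+ 2 * (kappa * t) + c2 ^+ 2 * (kappa * t) +
    (`|c1| * (G * e)) ^+ 2 * (t ^+ 2 * (kappa * t)) +
    (`|c2| * (G * e)) ^+ 2 * (t ^+ 2 * (kappa * t)) =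
    (c1 ^+ 2 + c2 ^+ 2) * (kappa * t * (1 + (G * (e * t)) ^+ 2)).
  by rewrite !(exprMn _ `|_|) !real_normK ?num_real//; ring.
rewrite c3E in le3; rewrite c12E in le4 sum4.
rewrite E5; move: le1 le2 le3 le4 le12 sum4.
(* With the nonlinear blocks named, what is left is a linear combination of the bounds above. *)
set A1 := (`|c1| * ((1 + G * e * t) * G * _)) ^+ 2.
set A2 := (`|c1| * ((1 + G * e * t) * G * L * e)) ^+ 2 * _.
set A3 := (`|c3| * _) ^+ 2.
set A4 := c1 ^+ 2 * (kappa * t); set A5 := c2 ^+ 2 * (kappa * t).
set A6 := (`|c1| * (G * e)) ^+ 2 * _; set A7 := (`|c2| * (G * e)) ^+ 2 * _.
set P1 := ((1 + G) * G * b0 * (1 + L * N)) ^+ 2.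
set P2 := ((1 + G) * G * L) ^+ 2; set P3 := ((1 + G) * K) ^+ 2.
set D1 := (1 - 2 * theta) ^+ 2; set D2 := (1 - 2 * theta ^+ 2) ^+ 2.
set Q := theta ^+ 2 - theta + 3^-1; set F := E ^+ 5.
move=> le1 le2 le3 le4 le12 sum4.
have s4 : A4 + A5 + A6 + A7 <= Q * T ^+ 2 * (kappa * T * ((1 + G ^+ 2) * F)).
  by rewrite sum4.
have s12 : A1 + A2 <= D1 * T ^+ 4 / 4 * (P1 + kappa * P2) * F.
  by apply: le_trans le12; rewrite mulrDr mulrDl lerD.
have -> : F * (7 / 4 * (P1 + kappa * P2) * D1 * T ^+ 4 +
    7 * kappa * (1 + G ^+ 2) * Q * T ^+ 3 + 7 / 16 * P3 * D2 * T ^+ 2) =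
  7 * (D1 * T ^+ 4 / 4 * (P1 + kappa * P2) * F +
    Q * T ^+ 2 * (kappa * T * ((1 + G ^+ 2) * F)) +
      D2 * T ^+ 2 / 16 * P3 * F) by field.
rewrite ler_wpM2l//; clear -s4 s12 le3; lra.
Qed.

(** The return to the Euclidean norm of the theorem from the l1 norm, which suits integrals that are
    defined entrywise. *)
Lemma enorm_sqr_le_l1norm (R : realType) (n : nat) (v : 'cV[R]_n) :
  enorm v ^+ 2 <= l1norm v ^+ 2.
Proof.
rewrite sqr_sqrtr; last by apply: sumr_ge0 => i _; exact: sqr_ge0.
rewrite [leRHS]expr2 mulr_suml ler_sum// => i _.
rewrite -(real_normK (num_real _)) expr2 ler_wpM2l//.
by rewrite /l1norm (bigD1 i)//= lerDl sumr_ge0.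
Qed.

Lemma sqr_sum7_le (R : realFieldType) (a1 a2 a3 a4 a5 a6 a7 : R) :
  (a1 + a2 + a3 + a4 + a5 + a6 + a7) ^+ 2 <=
  7 * (a1 ^+ 2 + a2 ^+ 2 + a3 ^+ 2 + a4 ^+ 2 + a5 ^+ 2 + a6 ^+ 2 + a7 ^+ 2).
Proof.
have := sqr_sum_le (fun i : 'I_7 => nth 0 [:: a1; a2; a3; a4; a5; a6; a7] i).
by rewrite !big_ord_recr !big_ord0 /= !add0r.
Qed.

Lemma measurable_enorm_sqr (dp : measure_display) (Omega : measurableType dp)
    (R : realType) (T : R) (F : R -> set (set Omega)) (n : nat)
    (U : R -> Omega -> 'cV[R]_n) (t : R) :
  filtration T F -> adapted T F U -> 0 <= t <= T ->
  measurable_fun setT (fun w => enorm (U t w) ^+ 2).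
Proof.
move=> [hF _] aU tT.
rewrite (_ : (fun w => _) = fun w => \sum_i U t w i 0 ^+ 2).
  apply: measurable_sum => i; apply: measurable_funX.
  by apply: sigma_measurable_measurable (aU t tT i); have [] := hF t tT.
apply/funext => w; rewrite sqr_sqrtr//.
by apply: sumr_ge0 => i _; exact: sqr_ge0.
Qed.

Unset Implicit Arguments.
Set Strict Implicit.
Set Printing Implicit Defensive.

Theorem theorem2p7 (R : realType) (d m : nat) (hd : (0 < d)%N) (hm : (0 < m)%N)
    (H : 'cV[R]_(d + d) -> R) (sigma : 'M[R]_(d + d, m)) (x0 : 'cV[R]_(d + d))
    (hC4 : class_C 4 H)
    (hbd : forall k : nat, (2 <= k <= 4)%N -> bounded_derivatives k H)
    (hconv : exists2 rho : R, 0 < rho & hessian_posdef_outside_ball H rho) :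
  exists C0 C1 C2 C3 : R,
    forall (theta T : R), 0 <= theta <= 1 -> 0 < T ->
    forall (dp : measure_display) (Omega : measurableType dp)
      (P : probability Omega R) (F : R -> set (set Omega))
      (W W' : R -> Omega -> 'cV[R]_m) (X U : R -> Omega -> 'cV[R]_(d + d)),
      filtration T F ->
      brownian_motion P T F W ->
      brownian_motion P T F W' ->
      independent_processes P T W W' ->
      sde_solution P T F (ham_field H) sigma x0 W X ->
      limit_error_solution P T F (ham_field H) sigma theta W W' X U ->
      forall t : R, 0 <= t <= T ->
        ('E_P[fun w => (enorm (U t w) ^+ 2)%R] <=
          (expR (C0 * t) *
            (C1 * (1 - 2 * theta) ^+ 2 * T ^+ 4
             + C2 * (theta ^+ 2 - theta + 3^-1) * T ^+ 3
             + C3 * (1 - 2 * theta ^+ 2) ^+ 2 * T ^+ 2))%:E)%E.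
Proof.
have [L [K [b0 [[L0 K0 b00] JacL D2K bL]]]] :=
  ham_field_bounds x0 hC4 (hbd 2 isT) (hbd 3 isT).
pose n := (d + d)%N; pose N : R := n%:R.
pose sg := \sum_i \sum_j `|sigma i j|.
have sg_row i : \sum_j `|sigma i j| <= sg.
  by rewrite /sg [leRHS](bigD1 i)//= lerDl; do 2 (apply: sumr_ge0 => ? _).
have sg_le i j : `|sigma i j| <= sg.
  by apply: le_trans (sg_row i); rewrite [leRHS](bigD1 j)//= lerDl sumr_ge0.
have sg0 : 0 <= sg by do 2 (apply: sumr_ge0 => ? _).
(* The 1 covers the integrand [sigma] of the noise of X, and L covers [Jac b * sigma], so one
   second-moment constant serves all three Ito integrals. *)
pose M := (1 + L) * sg.
have sigmaM i j : `|sigma i j| <= M.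
  by apply: le_trans (sg_le i j) _; rewrite ler_peMl// lerDl.
have JsigmaM z i j : `|(Jac (ham_field H) z *m sigma) i j| <= M.
  rewrite mxE (le_trans (ler_norm_sum _ _ _))//.
  apply: (@le_trans _ _ (\sum_k L * `|sigma k j|)).
    by apply: ler_sum => k _; rewrite normrM ler_wpM2r.
  rewrite -mulr_sumr; apply: ler_pM => //; first exact: sumr_ge0.
    by rewrite lerDr.
  by apply: ler_sum => k _; rewrite [leRHS](bigD1 j)//= lerDl sumr_ge0.
pose kappa := ito_second_moment n m M.
have kappa0 : 0 <= kappa by exact: ito_second_moment_ge0.
pose K' := m%:R * N * K * (\sum_k \sum_i \sum_j `|sigma i k| * `|sigma j k|).
have K'0 : 0 <= K'.
  rewrite !mulr_ge0//.
  by do 3 (apply: sumr_ge0 => ? _); rewrite mulr_ge0.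
pose G := N * L; have G0 : 0 <= G by rewrite mulr_ge0.
(* These are built from the derivative bounds of H, [sigma], the dimensions, and [x0] through b0;
   theta, T and the probability space are introduced only afterwards. *)
exists (5 * (G + 1)), (7 / 4 * (((1 + G) * G * b0 * (1 + L * N)) ^+ 2 +
        kappa * ((1 + G) * G * L) ^+ 2)), (7 * kappa * (1 + G ^+ 2)),
  (7 / 16 * ((1 + G) * K') ^+ 2).
move=> theta T _ T0 dp Omega P F W W' X U hF hW hW' _ [aX cX [I0 hI0 XE]]
  [aU cU [I1 [I2 [hI1 hI2 UE]]]] t tT.
have /andP[t0 tT'] := tT.
have sub : `[0, t] `<=` `[0, T] by apply: subset_itv; rewrite bnd_simp.
rewrite unlock; apply: integral_expectation_below.
- exact: (measurable_enorm_sqr hF aU tT).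
- by move=> w; exact: sqr_ge0.
apply: (expectation_below_leK
  (moment_constants_le theta tT G0 L0 (ler0n R n) b00 kappa0 K'0)).
set c1 := (1 - 2 * theta) * T / 2; set c2 := Num.sqrt 3 / 6 * T.
set c3 := (1 - 2 * theta ^+ 2) * T / 4; set e := expR (G * t).
have mI1 := ito_integral_vec_measurable hI1 tT.
have mI2 := ito_integral_vec_measurable hI2 tT.
pose Y (I : R -> Omega -> 'cV[R]_n) w :=
  \int[lebesgue_measure]_(s in `[0, t]) l1norm (I s w).
have eY0 : expectation_below P (fun w => Y I0 w ^+ 2) (t ^+ 2 * (kappa * t)).
  by apply: (ito_integral_vec_Rintegral_below hF hW hI0) => // i j s w;
    exact: sigmaM.
have eY1 : expectation_below P (fun w => Y I1 w ^+ 2) (t ^+ 2 * (kappa * t)).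
  by apply: (ito_integral_vec_Rintegral_below hF hW hI1) => // i j s w;
    exact: JsigmaM.
have eY2 : expectation_below P (fun w => Y I2 w ^+ 2) (t ^+ 2 * (kappa * t)).
  by apply: (ito_integral_vec_Rintegral_below hF hW' hI2) => // i j s w;
    exact: JsigmaM.
have eN1 : expectation_below P (fun w => l1norm (I1 t w) ^+ 2) (kappa * t).
  apply: expectation_below_integral => [|w|];
    [exact: measurable_funX|exact: sqr_ge0|].
  by apply: (ito_integral_vec_sqr_le hF hW hI1) => // i j s w; exact: JsigmaM.
have eN2 : expectation_below P (fun w => l1norm (I2 t w) ^+ 2) (kappa * t).
  apply: expectation_below_integral => [|w|];
    [exact: measurable_funX|exact: sqr_ge0|].
  by apply: (ito_integral_vec_sqr_le hF hW' hI2) => // i j s w; exact: JsigmaM.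
pose A1 := `|c1| * ((1 + G * e * t) * G * (b0 * t + L * e * (N * b0 * t * t))).
pose k2 := `|c1| * ((1 + G * e * t) * G * L * e).
pose A3 := `|c3| * ((1 + G * e * t) * K' * t).
(* The squares of the seven summands of the pathwise bound, whose expectations can be bounded one by
   one. *)
apply: (expectation_below_le (g := fun w =>
  7 * (A1 ^+ 2 + k2 ^+ 2 * Y I0 w ^+ 2 +
    A3 ^+ 2 + c1 ^+ 2 * l1norm (I1 t w) ^+ 2 + c2 ^+ 2 * l1norm (I2 t w) ^+ 2 +
    (`|c1| * (G * e)) ^+ 2 * Y I1 w ^+ 2 +
      (`|c2| * (G * e)) ^+ 2 * Y I2 w ^+ 2))); last first.
  apply: expectation_belowZ => //.
  by repeat (apply: expectation_belowD);
    first [exact/expectation_below_cst/sqr_ge0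
          |apply: expectation_belowZ => //; exact: sqr_ge0].
have cI0 := ito_integral_vec_continuous hI0.
have cI1 := ito_integral_vec_continuous hI1.
have cI2 := ito_integral_vec_continuous hI2.
(* From here on the argument runs along one path, outside the union of the null sets of the
   continuity statements and of the two equations. *)
apply: filterS (filterI (filterI (filterI cX cU) (filterI XE UE))
  (filterI cI0 (filterI cI1 cI2))) =>
    w [[[cXw cUw] [XEw UEw]] [cI0w [cI1w cI2w]]].
have coord (V : R -> 'cV[R]_n) : {within `[0, T], continuous V} ->
    forall i, {within `[0, t], continuous (fun s => V s i 0)}.
  move=> cV i; apply: (continuous_subspaceW sub) => s.
  apply: (cvg_comp V (fun v : 'cV[R]_n => v i 0) (cV s)).
  exact: coord_continuous.
have restr (V : R -> 'cV[R]_n) :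
    (forall i, {within `[0, T], continuous (fun s => V s i 0)}) ->
    forall i, {within `[0, t], continuous (fun s => V s i 0)}.
  by move=> cV i; apply: continuous_subspaceW sub (cV i).
have le_T s : 0 <= s <= t -> 0 <= s <= T.
  by move=> /andP[-> st]; exact: le_trans tT'.
have path : l1norm (U t w) <= A1 + k2 * Y I0 w + A3 + `|c1| * l1norm (I1 t w) +
    `|c2| * l1norm (I2 t w) + `|c1| * (G * e) * Y I1 w +
      `|c2| * (G * e) * Y I2 w.
  exact: (@limit_error_path_le R n t t0 (X^~ w) (I0^~ w) x0 (ham_field H) b0 L
    b00 L0 (coord _ cXw) (restr _ cI0w) bL (fun s st => XEw s (le_T s st))
    m sigma K K0 JacL D2K (U^~ w) (I1^~ w) (I2^~ w) c1 c2 c3 (coord _ cUw)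
    (restr _ cI1w) (restr _ cI2w) (fun s st => UEw s (le_T s st))).
apply: (le_trans (enorm_sqr_le_l1norm _)).
have u0 := l1norm_ge0 (U t w).
apply: (@le_trans _ _ ((A1 + k2 * Y I0 w + A3 + `|c1| * l1norm (I1 t w) +
    `|c2| * l1norm (I2 t w) + `|c1| * (G * e) * Y I1 w +
      `|c2| * (G * e) * Y I2 w) ^+ 2)).
  by rewrite lerXn2r// nnegrE// (le_trans u0 path).
apply: le_trans (sqr_sum7_le _ _ _ _ _ _ _) _.
rewrite !(exprMn 2 _ (Y _ w)) !(exprMn 2 _ (l1norm _)).
by rewrite (real_normK (num_real c1)) (real_normK (num_real c2)).
Qed.
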